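(* Suppose there exists $m > 0$ such that $$\sup_{d \ge 0} \mathbb{E}\Big( (Y-d)^2 \, e^{\frac{\gamma}{\sqrt{m}}(Y-d)} \,\Big|\, Y > d \Big) < \infty,$$ where the supremum runs over those $d \ge 0$ with $\mathbb{P}(Y>d) > 0$. Then there exist $C > 0$ and $N > 0$ such that, for all $n > N$ and all $x \ge 0$, $$\big| \psi_n(x) - \psi_D(x) \big| \le \frac{C}{\sqrt{n}},$$ where $\psi_D(x) = e^{-\gamma x}$ and $\gamma = 2\theta\, \mathbb{E}Y / \mathbb{E}(Y^2)$.
   Context: Setting: $\lambda > 0$ and $\theta > 0$ are constants, and $Y$ is a positive random variable (the claim size) whose moment generating function $\mathbb{E}(e^{uY})$ is finite for all $u$ in some neighborhood $(-u_0,u_0)$ of $0$, $u_0>0$. Let $Y_1, Y_2, \dots$ be i.i.d. copies of $Y$. Scaled Cram\'er--Lundberg model: for $n > 0$, let $\lambda_n = n\lambda$, $c_n = (\sqrt{n} + \theta)\lambda\, \mathbb{E}Y$, let $N^{(n)} = \{N^{(n)}_t\}_{t\ge 0}$ be a homogeneous Poisson process with intensity $\lambda_n$, independent of $\{Y_i\}$, and for $x \ge 0$ let $$X^{(n)}_t = x + c_n t - \sum_{i=1}^{N^{(n)}_t} \frac{Y_i}{\sqrt{n}}, \quad t \ge 0.$$ The probability of (ultimate) ruin is $\psi_n(x) = \mathbb{P}(\tau_n < \infty \mid X_0^{(n)} = x)$, where $\tau_n = \inf\{t \ge 0 : X^{(n)}_t < 0\}$. $\psi_D(x) = e^{-\gamma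 x}$, with $\gamma = 2\theta\,\mathbb{E}Y/\mathbb{E}(Y^2)$, is the probability of ruin of the limiting diffusion, a Brownian motion with drift $\lambda\theta\,\mathbb{E}Y$ and volatility $\sqrt{\lambda\, \mathbb{E}(Y^2)}$ started at $x$. *)

(* Defs.v *)
From HB Require Import structures.
From mathcomp Require Import all_boot all_order all_algebra.
From mathcomp Require Import all_classical all_reals all_analysis.

Set Implicit Arguments.
Unset Strict Implicit.
Unset Printing Implicit Defensive.

Import Order.TTheory GRing.Theory Num.Theory.
Import numFieldNormedType.Exports.

Local Open Scope classical_set_scope.
Local Open Scope ring_scope.

Definition mutually_independent d d' (T : measurableType d)
    (T' : measurableType d') (R : realType) (P : probability T R)
    (I : choiceType) (X : I -> T -> T') : Prop :=
  forall (J : seq I) (B : I -> set T'), uniq J ->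
    (forall i, measurable (B i)) ->
    P (\bigcap_(i in [set` J]) (X i @^-1` B i)) =
    (\prod_(i <- J) P (X i @^-1` B i))%E.

Definition same_distribution d d' (T : measurableType d)
    (T' : measurableType d') (R : realType) (P : probability T R)
    (X Z : {RV P >-> T'}) : Prop :=
  forall B : set T', measurable B -> distribution P X B = distribution P Z B.

(* sigma(X i : i in D) *)
Definition sigma_generated d d' (T : measurableType d)
    (T' : measurableType d') (I : Type) (D : set I) (X : I -> T -> T') :
    set (set T) :=
  <<s \bigcup_(i in D) preimage_set_system setT (X i) measurable >>.

Definition independent_systems d (T : measurableType d) (R : realType)
    (P : probability T R) (F G : set (set T)) : Prop :=
  forall A B : set T, F A -> G B -> P (A `&` B) = (P A * P B)%E.

Arguments same_distribution {d d' T T' R} P X Z.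

(* A counting process is a homogeneous Poisson process when its interarrival
   times W 0, W 1, ... are i.i.d. exponential: with S_k = W 0 + ... + W k.-1
   the time of the k-th jump, N_t is the number of k >= 1 such that S_k <= t.
   In particular N_0 = 0, and every path is right-continuous, finite, and has
   jumps of size 1. Only the values of N t for t >= 0 matter. *)
Definition poisson_process d (T : measurableType d) (R : realType)
    (P : probability T R) (rate : R) (N : R -> T -> nat) : Prop :=
  exists W : nat -> {RV P >-> R},
    [/\ mutually_independent P (fun k => (W k : T -> R)),
        (forall k (B : set R), measurable B ->
           distribution P (W k) B = exponential_prob rate B),
        (forall k w, 0 < W k w) &
        forall (t : R) (w : T) (k : nat), 0 <= t ->
          (k <= N t w)%N <-> \sum_(i < k) W i w <= t].

(* E(X | A) for an event A of positive probability *)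
Definition cond_expectation d (T : measurableType d) (R : realType)
    (P : probability T R) (X : T -> R) (A : set T) : \bar R :=
  ((\int[P]_(w in A) (X w)%:E) * ((fine (P A))^-1)%:E)%E.

Section CramerLundberg.
Context d (T : measurableType d) (R : realType) (P : probability T R).
Variables (lambda theta : R) (Y : T -> R).

Definition mean_claim : R := fine 'E_P[Y].

Definition mean_sq_claim : R := fine 'E_P[fun w => Y w ^+ 2].

Definition premium_rate (n : R) : R :=
  (Num.sqrt n + theta) * lambda * mean_claim.

Definition adjustment : R := 2 * theta * mean_claim / mean_sq_claim.

Definition ruin_prob_diffusion (x : R) : R := expR (- (adjustment * x)).

Variables (Ys : nat -> T -> R) (N : R -> R -> T -> nat).

Definition surplus (n x t : R) (w : T) : R :=
  x + premium_rate n * t - \sum_(i < N n t w) Ys i w / Num.sqrt n.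

Definition ruin_time (n x : R) (w : T) : \bar R :=
  ereal_inf [set t%:E | t in [set t : R | 0 <= t /\ surplus n x t w < 0]].

Definition ruin_prob (n x : R) : R :=
  fine (P [set w | (ruin_time n x w < +oo)%E]).

End CramerLundberg.

(* Main.v *)
Require Import Defs.
From HB Require Import structures.
From mathcomp Require Import all_boot all_order all_algebra.
From mathcomp Require Import all_classical all_reals all_analysis.
From mathcomp Require Import measurable_realfun ring lra.

Set Implicit Arguments.
Unset Strict Implicit.
Unset Printing Implicit Defensive.

Import Order.TTheory GRing.Theory Num.Theory.
Import numFieldNormedType.Exports.

Local Open Scope classical_set_scope.
Local Open Scope ring_scope.

(** Ruin can only happen at a claim, so it is the event that the walk
    [x + \sum_(i < k) (c * W i - e * Y i)] becomes negative for some [k], where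
    the [W i] are the interarrival times, the [Y i] the claims, [c] the premium
    rate and [e = 1 / sqrt n]. Let [V k] be this walk stopped when it becomes
    negative. Write [mu] and [mu2] for the first two moments of a claim and
    [M] for its moment generating function. As the interarrival times are
    exponential, one step of the walk multiplies [exp (- r V)] on average by
    [M (r e) / (1 + r e mu (1 + theta e))] ([premium_laplaceE]), and
    [M s = 1 + s mu + s ^ 2 mu2 / 2 + O (s ^ 3)] ([mgf_taylor]). The rate
    [gamma = 2 theta mu / mu2] is the one at which the quadratic term of [M]
    equals the contribution of the safety loading [theta]. Hence the factor is
    at least 1 for [r = gamma], because the remainder is nonnegative
    ([mgf_at_adjustment]), and less than 1 for [r = gamma - K e] with [K] large
    enough ([mgf_below_adjustment]).

    Upper bound. For [r = gamma - K e] the process [exp (- r V)] is a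
    supermartingale that is at least 1 on ruin, so the ruin probability is at
    most [exp (- r x)] ([ever_ruined_le]), which exceeds [exp (- gamma x)] by
    at most [2 K e / gamma], uniformly in [x] ([expR_decrement]).

    Lower bound. Let [g v] be 1 for [v < 0] and [a exp (- gamma v)] otherwise.
    A claim that causes ruin would contribute to the mean of
    [exp (- gamma V)] the exponential of its overshoot, but contributes only 1
    to that of [g]. The moment condition on the residual claims bounds the
    mean exponential overshoot by [1 + gamma e A] ([overshoot]), so
    [a = 1 / (1 + gamma e A)] makes [g V] a submartingale
    ([one_step_subsolution]). Its part on survival tends to 0, being dominated
    by [exp (- r V)], whose mean on survival decays geometrically when
    [r = gamma - K e]. In the limit the ruin probability is at least
    [a exp (- gamma x)] ([ever_ruined_ge]), and [1 - a = O (e)].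

    Both bounds need one-step means of [V k.+1] given the past. They are
    computed by freezing [V k] ([integral_freezing]), once it is shown that the
    interarrival times, hence the whole sequence of interarrival times and
    claims, inherit independence from the Poisson process and the claims
    ([interarrival_sigma_generated], [mutually_independent_sum]). *)

(** * Independence and freezing *)

Section independence.
Context d (T : measurableType d) (R : realType) (P : probability T R).

(** Conditioning on [X] amounts to integrating over an independent copy of
    [Z] with [X] frozen: by independence the law of the pair is the product of
    the laws, and the right-hand side is Tonelli's theorem. *)
Lemma integral_freezing d1 d2 (T1 : measurableType d1) (T2 : measurableType d2)
    (X : {RV P >-> T1}) (Z : {RV P >-> T2}) (f : T1 * T2 -> \bar R) :
  (forall A B, measurable A -> measurable B ->
     P (X @^-1` A `&` Z @^-1` B) = (P (X @^-1` A) * P (Z @^-1` B))%E) ->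
  measurable_fun setT f -> (forall p, (0 <= f p)%E) ->
  (\int[P]_w f (X w, Z w) = \int[P]_w \int[P]_w' f (X w, Z w'))%E.
Proof.
move=> XZ mf f0.
have mXZ : measurable_fun [set: T] (fun w => (X w, Z w)).
  by apply: measurable_fun_pair.
(* [V] is the pair as one random variable, so that it has a distribution. *)
pose XZm := isMeasurableFun.Build _ _ _ _ (fun w => (X w, Z w)) mXZ.
pose V : {RV P >-> (T1 * T2)%type} := HB.pack (fun w => (X w, Z w)) XZm.
transitivity (\int[distribution P V]_y f y)%E.
  by rewrite (ge0_integral_distribution V mf).
transitivity (\int[distribution P X \x distribution P Z]_y f y)%E.
  apply: eq_measure_integral => C mC _; apply/esym.
  by apply: (@product_measure_unique _ _ _ _ _
    (distribution P X) (distribution P Z) (distribution P V)).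
rewrite (fubini_tonelli1 f)//.
rewrite (@ge0_integral_distribution _ _ _ _ _ P X); last 2 first.
- exact: measurable_fun_fubini_tonelli_F.
- by move=> x; apply: integral_ge0.
apply: eq_integral => w _; rewrite /= /fubini_F.
rewrite (@ge0_integral_distribution _ _ _ _ _ P Z (fun z => f (X w, z)))//.
by apply: measurableT_comp => //; exact: measurable_pair1.
Qed.

(** Both sides are finite measures in [A] that agree on the intersections of
    finitely many preimages, a pi-system which generates the sigma-algebra. *)
Lemma independent_sigma_generated (I : choiceType) (Z : I -> {RV P >-> R})
    (D : set I) (j : I) (A : set T) (B : set R) :
  mutually_independent P (fun i => (Z i : T -> R)) -> ~ D j ->
  sigma_generated D (fun i => (Z i : T -> R)) A -> measurable B ->
  P (A `&` Z j @^-1` B) = (P A * P (Z j @^-1` B))%E.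
Proof.
move=> indZ Dj sA mB.
have mZj : measurable (Z j @^-1` B).
  by rewrite -[_ @^-1` _]setTI; exact: measurable_funPT.
pose cyl (JC : seq I * (I -> set R)) : set T :=
  \bigcap_(i in [set` JC.1]) (Z i @^-1` JC.2 i).
pose G := [set cyl JC | JC in [set JC : seq I * (I -> set R) |
  [/\ uniq JC.1, (forall i, i \in JC.1 -> D i) &
      forall i, measurable (JC.2 i)]]].
have Gm : G `<=` measurable.
  move=> _ [[J C] [/= uJ JD mC] <-]; apply: fin_bigcap_measurable => // i _.
  by rewrite -[_ @^-1` _]setTI; exact: measurable_funPT.
have GI : setI_closed G.
  move=> _ _ [[J C] [/= uJ JD mC] <-] [[J' C'] [/= uJ' JD' mC'] <-].
  pose C2 i := (if i \in J then C i else setT) `&`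
               (if i \in J' then C' i else setT).
  exists (undup (J ++ J'), C2).
    split=> /=; first exact: undup_uniq.
    - by move=> i; rewrite mem_undup mem_cat => /orP[/JD|/JD'].
    - by move=> i; apply: measurableI; case: ifP.
  apply/seteqP; split=> w /=.
    move=> H; split=> i /= iJ.
      have := H i; rewrite /= mem_undup mem_cat iJ => /(_ isT).
      by rewrite /C2 iJ => -[].
    have := H i; rewrite /= mem_undup mem_cat iJ orbT => /(_ isT).
    by rewrite /C2 iJ => -[].
  move=> [H H'] i /= _; rewrite /C2; split.
    by case: ifP => // iJ; apply: H.
  by case: ifP => // iJ; apply: H'.
have GT : G setT.
  exists ([::], fun=> setT); first by split => //= i; rewrite in_nil.
  by apply/seteqP; split => // w _ i.
(* The two measures of [A] to be compared. *)
pose m1 := mrestr P mZj.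
have r0 : 0 <= fine (P (Z j @^-1` B)) by apply: fine_ge0.
pose m2 := mscale (NngNum r0) P.
have GE : forall E, <<s G >> E -> m1 E = m2 E.
  move=> E.
  apply: (@g_sigma_algebra_measure_unique _ _ _ G Gm (fun=> setT)) => //.
  - by apply/seteqP; split => // w _; exists 0%N.
  - move=> _ [[J C] [/= uJ JD mC] <-].
    rewrite /m1 /m2 /mrestr /mscale/= fineK//; last exact: fin_num_measure.
    have jJ : j \notin J by apply/negP => /JD.
    pose C1 i := if i == j then B else C i.
    have -> : cyl (J, C) `&` Z j @^-1` B = cyl (j :: J, C1).
      apply/seteqP; split=> w /=.
        move=> [H H'] i /=; rewrite inE => /orP[/eqP->|iJ]; rewrite /C1 ?eqxx//.
        by case: eqP => [->//|_]; apply: H.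
      move=> H; split; last by have := H j; rewrite /= inE eqxx /C1 eqxx; exact.
      move=> i /= iJ; have := H i; rewrite /= inE iJ orbT /C1 => /(_ isT).
      by case: eqP iJ jJ => // ->; case: (j \in J).
    rewrite {1}/cyl indZ//; last 2 first.
    - by rewrite /= jJ.
    - by move=> i; rewrite /= /C1; case: ifP.
    rewrite big_cons /= /C1 eqxx; congr (_ * _)%E.
    rewrite /cyl/= indZ//; apply: eq_big_seq => i iJ; rewrite /C1.
    by case: eqP iJ jJ => // ->; case: (j \in J).
  - by move=> k; apply: le_lt_trans (ltry 1); apply: probability_le1;
    exact: measurableI.
have : <<s G >> A.
  move: A sA; apply: sub_smallest2r; first exact: smallest_sigma_algebra.
  move=> _ [i Di [C mC <-]].
  exists ([:: i], fun=> C); first by split=> //= k; rewrite inE => /eqP ->.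
  rewrite setTI; apply/seteqP; split => w /=.
    by move=> H; apply: (H i) => /=; rewrite inE.
  by move=> H k /=; rewrite inE => /eqP ->.
move=> /GE; rewrite /m1 /m2 /mrestr /mscale/= fineK ?fin_num_measure//.
by rewrite muleC.
Qed.

End independence.

(** * Independence of interarrival times and claims *)

Section poisson_claims.
Context d (T : measurableType d) (R : realType) (P : probability T R).

Definition sum_family (I I' : Type) (X : I -> {RV P >-> R})
    (Y : I' -> {RV P >-> R}) (i : I + I') : {RV P >-> R} :=
  match i with inl j => X j | inr j => Y j end.

Lemma bigcap_sigma_generated (I : choiceType) (X : I -> {RV P >-> R})
    (J : seq I) (B : I -> set R) : (forall i, measurable (B i)) ->
  sigma_generated setT (fun i => (X i : T -> R))
    (\bigcap_(i in [set` J]) (X i @^-1` B i)).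
Proof.
move=> mB.
pose G := \bigcup_(i in [set: I])
  preimage_set_system setT (X i : T -> R) measurable.
apply: (@fin_bigcap_measurable _ (g_sigma_algebraType G)) => // i _.
apply: sub_sigma_algebra; exists i => //; exists (B i) => //.
by rewrite setTI.
Qed.

(** A finite subfamily splits into its indices on either side of the sum, and
    each half is an event of the corresponding sigma-algebra. *)
Lemma mutually_independent_sum (I I' : choiceType) (X : I -> {RV P >-> R})
    (Y : I' -> {RV P >-> R}) :
  mutually_independent P (fun i => (X i : T -> R)) ->
  mutually_independent P (fun i => (Y i : T -> R)) ->
  independent_systems P (sigma_generated setT (fun i => (X i : T -> R)))
    (sigma_generated setT (fun i => (Y i : T -> R))) ->
  mutually_independent P (fun i => (sum_family X Y i : T -> R)).
Proof.
move=> iX iY iXY J B uJ mB.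
pose l (i : I + I') := if i is inl j then Some j else None.
pose r (i : I + I') := if i is inr j then Some j else None.
have meml j : (j \in pmap l J) = (inl j \in J).
  by rewrite mem_pmap; elim: J {uJ} => //= -[i|i] J IH; rewrite !inE IH.
have memr j : (j \in pmap r J) = (inr j \in J).
  by rewrite mem_pmap; elim: J {uJ meml} => //= -[i|i] J IH; rewrite !inE IH.
have -> : \bigcap_(i in [set` J]) (sum_family X Y i @^-1` B i) =
    (\bigcap_(i in [set` pmap l J]) (X i @^-1` B (inl i))) `&`
    (\bigcap_(i in [set` pmap r J]) (Y i @^-1` B (inr i))).
  apply/seteqP; split => w /=.
    move=> H; split => i /=; first by rewrite meml => /H.
    by rewrite memr => /H.
  move=> [H H'] [i|i] /= iJ; first by apply: H; rewrite /= meml.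
  by apply: H'; rewrite /= memr.
rewrite iXY; last 2 first.
- by apply: bigcap_sigma_generated => i.
- by apply: bigcap_sigma_generated => i.
rewrite iX//; last by apply: (@pmap_uniq _ _ l inl) => // -[].
rewrite iY//; last by apply: (@pmap_uniq _ _ r inr) => // -[].
elim: {uJ meml memr}J => [|[i|i] J IH] /=; first by rewrite !big_nil mule1.
- by rewrite !big_cons -IH muleA.
- by rewrite !big_cons -IH muleCA.
Qed.

(** The Poisson process determines its jump times: the [k]-th one exceeds
    [t >= 0] exactly when fewer than [k] jumps have occurred by time [t].
    Interarrival times are differences of jump times. *)
Lemma interarrival_sigma_generated (N : R -> T -> nat)
    (W : nat -> {RV P >-> R}) :
  (forall k w, 0 < W k w) ->
  (forall (t : R) (w : T) (k : nat), 0 <= t ->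
     (k <= N t w)%N <-> \sum_(i < k) W i w <= t) ->
  sigma_generated setT (fun k => (W k : T -> R)) `<=`
  sigma_generated [set t : R | 0 <= t] N.
Proof.
move=> W0 NW; apply: smallest_sub; first exact: smallest_sigma_algebra.
pose G := \bigcup_(t in [set t : R | 0 <= t])
  preimage_set_system setT (N t) measurable.
pose S k : g_sigma_algebraType G -> R := fun w => \sum_(i < k) W i w.
have mS k : measurable_fun setT (S k).
  move=> _; apply: (measurability _ (RGenOInfty.measurableE R)) => //.
  move=> _ [_ [t ->] <-]; rewrite setTI.
  (* [N t] is constrained only for [t >= 0]; for [t < 0] the event is sure. *)
  have [t0|t0] := leP 0 t.
    rewrite (_ : _ @^-1` _ = ~` (N t @^-1` [set m | (k <= m)%N])).
      apply: measurableC; apply: sub_sigma_algebra; exists t => //.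
      by exists [set m | (k <= m)%N] => //; rewrite setTI.
    apply/seteqP; split => w /=; rewrite in_itv/= andbT.
      by move=> St /(NW _ _ _ t0); rewrite leNgt St.
    by move=> H; rewrite ltNge; apply/negP => /(NW _ _ _ t0).
  rewrite (_ : _ @^-1` _ = setT)//; apply/seteqP; split => w //= _.
  rewrite in_itv/= andbT (lt_le_trans t0)//.
  by apply: sumr_ge0 => i _; exact: ltW.
move=> _ [k _ [B mB <-]].
have mW : measurable_fun setT (fun w : g_sigma_algebraType G => W k w).
  rewrite (_ : (fun w => W k w) = (fun w => S k.+1 w - S k w)).
    exact: measurable_funB.
  by apply/funext => w; rewrite /S big_ord_recr/= addrAC subrr add0r.
exact: mW.
Qed.

End poisson_claims.

(** * The surplus at claim times, stopped at ruin *)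

Section generated_measurability.
Context d (T : measurableType d) (R : realType) (P : probability T R).

(** The type [T] equipped with the sigma-algebra generated by [Z i], [i] in
    [D]: measurability from it is proved with the usual combinators. *)
Definition generated_type (I : choiceType) (Z : I -> {RV P >-> R})
    (D : set I) :=
  g_sigma_algebraType (\bigcup_(i in D)
    preimage_set_system setT (Z i : T -> R) measurable).

Lemma generated_type_measurable (I : choiceType) (Z : I -> {RV P >-> R})
    (D : set I) d1 (T1 : measurableType d1) (X : T -> T1) :
  measurable_fun setT (X : generated_type Z D -> T1) -> measurable_fun setT X.
Proof.
move=> mX _ A mA; have := mX measurableT A mA; rewrite !setTI.
apply: (@smallest_sub _ _ _ (d.-measurable)).
  exact: sigma_algebra_measurable.
by move=> _ [i _ [B mB <-]]; exact: measurable_funPT.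
Qed.

Lemma measurable_generator (I : choiceType) (Z : I -> {RV P >-> R})
    (D : set I) i : D i ->
  measurable_fun setT (Z i : generated_type Z D -> R).
Proof.
move=> Di _ B mB; apply: sub_sigma_algebra; exists i => //.
by exists B.
Qed.

Lemma generated_type_sub (I : choiceType) (Z : I -> {RV P >-> R})
    (D D' : set I) d1 (T1 : measurableType d1) (X : T -> T1) :
  D `<=` D' -> measurable_fun setT (X : generated_type Z D -> T1) ->
  measurable_fun setT (X : generated_type Z D' -> T1).
Proof.
move=> DD' mX _ A mA; have := mX measurableT A mA.
apply: sub_sigma_algebra2; exact: bigcup_subset.
Qed.

Lemma integral_freezing_generated (I : choiceType) (Z : I -> {RV P >-> R})
    (D : set I) (j : I) d1 (T1 : measurableType d1) (X : T -> T1)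
    (f : T1 * R -> \bar R) :
  mutually_independent P (fun i => (Z i : T -> R)) -> ~ D j ->
  measurable_fun setT (X : generated_type Z D -> T1) ->
  measurable_fun setT f -> (forall p, (0 <= f p)%E) ->
  (\int[P]_w f (X w, Z j w) = \int[P]_w \int[P]_w' f (X w, Z j w'))%E.
Proof.
move=> iZ Dj mX mf f0.
have mX' := generated_type_measurable mX.
pose XM := isMeasurableFun.Build _ _ _ _ X mX'.
pose V : {RV P >-> T1} := HB.pack X XM.
apply: (@integral_freezing _ _ _ P _ _ T1 _ V (Z j)) => // A B mA mB.
apply: (independent_sigma_generated iZ Dj) => //.
by have := mX measurableT A mA; rewrite setTI.
Qed.

End generated_measurability.

Section stopped_walk.
Context d (T : measurableType d) (R : realType) (P : probability T R).
Variables (W Y : nat -> {RV P >-> R}) (c e x : R).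
Hypothesis indep :
  mutually_independent P (fun i => (sum_family W Y i : T -> R)).

(** Stopping the walk keeps all the information needed on ruin in one real
    number: ruin has occurred within [k] claims exactly when [stopped k] is
    negative. *)
Fixpoint stopped (k : nat) (w : T) : R :=
  if k is j.+1 then
    if stopped j w < 0 then stopped j w
    else stopped j w + c * W j w - e * Y j w
  else x.

Let past k : set (nat + nat) :=
  [set i | match i with inl j => (j < k)%N | inr j => (j < k)%N end].

Let next (p : R * R * R) : R :=
  if p.1.1 < 0 then p.1.1 else p.1.1 + c * p.1.2 - e * p.2.

Let measurable_next d1 (T1 : measurableType d1) (f g h : T1 -> R) :
  measurable_fun setT f -> measurable_fun setT g -> measurable_fun setT h ->
  measurable_fun setT (fun w => next (f w, g w, h w)).
Proof.
move=> mf mg mh; apply: measurable_fun_ifT => //=.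
- exact: measurable_fun_ltr.
- apply: measurable_funB; last exact: measurable_funM.
  by apply: measurable_funD => //; exact: measurable_funM.
Qed.

Let stopped_past k : measurable_fun setT
  (stopped k : generated_type (sum_family W Y) (past k) -> R).
Proof.
elim: k => [|k IH] /=; first exact: measurable_cst.
have sub : past k `<=` past k.+1 by move=> [i|i] /= /ltnW.
pose TG := generated_type (sum_family W Y) (past k.+1).
apply: (@measurable_next _ TG (stopped k) (W k) (Y k)).
- exact: (generated_type_sub sub IH).
- by apply: (measurable_generator (Z := sum_family W Y) (i := inl k)) => /=.
- by apply: (measurable_generator (Z := sum_family W Y) (i := inr k)) => /=.
Qed.

Lemma measurable_stopped k : measurable_fun setT (stopped k).
Proof. exact: generated_type_measurable (@stopped_past k). Qed.

(** The outer and the inner integral run over independent copies of an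
    interarrival time and of a claim. *)
Definition one_step (k : nat) (phi : R -> \bar R) (v : R) : \bar R :=
  (\int[P]_w1 \int[P]_w2 phi (v + c * W k w1 - e * Y k w2)%R)%E.

(** The current claim and interarrival time are frozen one after the other:
    the claim is independent of the past together with the interarrival time,
    which is itself independent of the past. *)
Lemma integral_stoppedS k (phi : R -> \bar R) :
  measurable_fun setT phi -> (forall v, (0 <= phi v)%E) ->
  let K v := if v < 0 then phi v else one_step k phi v in
  measurable_fun setT K /\
  (\int[P]_w phi (stopped k.+1 w) = \int[P]_w K (stopped k w))%E.
Proof.
move=> mphi phi0 K.
have mf : measurable_fun setT (phi \o next).
  apply: measurableT_comp => //.
  have -> : next = (fun p => next (p.1.1, p.1.2, p.2)) by [].
  by apply: measurable_next => //; exact: measurableT_comp.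
pose g p := (\int[P]_w2 phi (next (p, Y k w2)))%E.
have mg : measurable_fun setT g.
  apply: (@measurable_fun_fubini_tonelli_F _ _ _ _ _ P
    (fun p : (R * R) * T => phi (next (p.1, Y k p.2)))) => //.
  have -> : (fun p : (R * R) * T => phi (next (p.1, Y k p.2))) =
    (phi \o next) \o (fun p : (R * R) * T => (p.1, Y k p.2)) by [].
  apply: measurableT_comp => //; apply: measurable_fun_pair => //.
  exact: measurableT_comp.
have g0 p : (0 <= g p)%E by apply: integral_ge0.
have KE v : K v = (\int[P]_w1 g (v, W k w1))%E.
  rewrite /K; case: ifPn => v0; last first.
    apply: eq_integral => w1 _; apply: eq_integral => w2 _.
    by rewrite /next /= (negbTE v0).
  under eq_integral => w1 _.
    rewrite /g; under eq_integral => w2 _ do rewrite /next /= v0.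
    rewrite integral_cst//= probability_setT mule1.
    over.
  by rewrite integral_cst//= probability_setT mule1.
split.
  rewrite (_ : K = fun v => \int[P]_w1 g (v, W k w1))%E; last exact/funext.
  apply: (@measurable_fun_fubini_tonelli_F _ _ _ _ _ P
    (fun p : R * T => g (p.1, W k p.2))) => //.
  have -> : (fun p : R * T => g (p.1, W k p.2)) =
    g \o (fun p : R * T => (p.1, W k p.2)) by [].
  apply: measurableT_comp => //; apply: measurable_fun_pair => //.
  exact: measurableT_comp.
pose D := past k `|` [set inl k].
have mX : measurable_fun setT ((fun w => (stopped k w, W k w)) :
    generated_type (sum_family W Y) D -> R * R).
  apply: measurable_fun_pair.
    by apply: generated_type_sub (@stopped_past k) => i; left.
  by apply: (measurable_generator (Z := sum_family W Y) (i := inl k)); right.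
transitivity (\int[P]_w (phi \o next) ((stopped k w, W k w),
    sum_family W Y (inr k) w))%E; first by [].
have Dk : ~ D (inr k) by move=> [/=|//]; rewrite ltnn.
rewrite (integral_freezing_generated indep Dk mX mf); last by
  move=> p; exact: phi0.
transitivity (\int[P]_w g (stopped k w, sum_family W Y (inl k) w))%E => //.
have pastk : ~ past k (inl k) by rewrite /= ltnn.
rewrite (integral_freezing_generated indep pastk (@stopped_past k) mg g0).
by apply: eq_integral => w _; rewrite KE.
Qed.

End stopped_walk.

(** * Super- and submartingale bounds up to a fixed number of claims *)

Section ruin_penalty.
Variable R : realType.

(** The submartingale of the lower bound is this function of the stopped
    walk: 1 after ruin and, if [r] is the adjustment rate, a multiple of the
    diffusion ruin probability before. *)
Definition ruin_penalty (a r v : R) : \bar R :=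
  (if v < 0 then 1 else a * expR (- (r * v)))%:E.

Lemma measurable_ruin_penalty a r : measurable_fun setT (ruin_penalty a r).
Proof.
apply/measurable_EFinP; apply: measurable_fun_ifT => //.
  exact: measurable_fun_ltr.
apply: measurable_funM => //; apply: measurableT_comp => //.
by apply: measurableT_comp => //; apply: measurable_funM.
Qed.

Lemma ruin_penalty_ge0 a r v : 0 <= a -> (0 <= ruin_penalty a r v)%E.
Proof.
by move=> a0; rewrite lee_fin; case: ifP => // _; rewrite mulr_ge0 ?expR_ge0.
Qed.

End ruin_penalty.

Lemma mean_expR_ge0 d (T : measurableType d) (R : realType)
    (P : probability T R) (f : T -> R) (l : R) :
  (\int[P]_w (expR (f w))%:E = l%:E)%E -> 0 <= l.
Proof.
by move=> lE; rewrite -lee_fin -lE; apply: integral_ge0 => w _;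
  rewrite lee_fin expR_ge0.
Qed.

Section ruin_bounds.
Context d (T : measurableType d) (R : realType) (P : probability T R).
Variables (W Y : nat -> {RV P >-> R}) (c e x : R).
Hypothesis indep :
  mutually_independent P (fun i => (sum_family W Y i : T -> R)).
Hypothesis x0 : 0 <= x.

Local Notation V := (stopped W Y c e x).
Local Notation one_step := (one_step W Y c e).

Lemma integral_stopped_decrease (phi : R -> \bar R) (q : R) k :
  measurable_fun setT phi -> (forall v, (0 <= phi v)%E) -> 0 <= q ->
  (forall v, v < 0 -> (phi v <= q%:E * phi v)%E) ->
  (forall v, 0 <= v -> (one_step k phi v <= q%:E * phi v)%E) ->
  (\int[P]_w phi (V k.+1 w) <= q%:E * \int[P]_w phi (V k w))%E.
Proof.
move=> mphi phi0 q0 neg pos.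
have [mK ->] := integral_stoppedS c e x indep k mphi phi0.
have mV := measurable_stopped W Y c e x k.
rewrite -ge0_integralZl_EFin//; last exact: (measurableT_comp mphi mV).
apply: ge0_le_integral => //.
- by move=> w _; case: ifP => // _; apply: integral_ge0 => ? _;
  apply: integral_ge0.
- exact: (measurableT_comp mK mV).
- by apply: measurable_funeM; exact: (measurableT_comp mphi mV).
- by move=> w _; case: ltP => [/neg|/pos].
Qed.

Lemma integral_stopped_increase (phi : R -> \bar R) k :
  measurable_fun setT phi -> (forall v, (0 <= phi v)%E) ->
  (forall v, 0 <= v -> (phi v <= one_step k phi v)%E) ->
  (\int[P]_w phi (V k w) <= \int[P]_w phi (V k.+1 w))%E.
Proof.
move=> mphi phi0 pos.
have [mK ->] := integral_stoppedS c e x indep k mphi phi0.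
have mV := measurable_stopped W Y c e x k.
apply: ge0_le_integral => //.
- exact: (measurableT_comp mphi mV).
- exact: (measurableT_comp mK mV).
- by move=> w _; case: ltP => [//|/pos].
Qed.

Lemma integral_stopped0 (phi : R -> \bar R) : (\int[P]_w phi (V 0 w) = phi x)%E.
Proof. by rewrite /= integral_cst//= probability_setT mule1. Qed.

Lemma measurable_ruined k : measurable [set w | (V k w < 0)%R].
Proof.
have mV := measurable_stopped W Y c e x k.
have -> : [set w | (V k w < 0)%R] = V k @^-1` `]-oo, 0[%classic.
  by apply/seteqP; split => w /=; rewrite in_itv.
by rewrite -[_ @^-1` _]setTI; apply: mV.
Qed.

Lemma measurable_after_claim k (phi : R -> \bar R) u :
  measurable_fun setT phi ->
  measurable_fun setT (fun w => phi (u - e * Y k w)).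
Proof.
move=> mphi; apply: (measurableT_comp mphi).
by apply: measurable_funB => //; apply: measurable_funM.
Qed.

Lemma measurable_mean_after_claim k (phi : R -> \bar R) v :
  measurable_fun setT phi -> (forall u, (0 <= phi u)%E) ->
  measurable_fun setT
    (fun w1 => \int[P]_w2 phi (v + c * W k w1 - e * Y k w2)%R)%E.
Proof.
move=> mphi phi0.
apply: (@measurable_fun_fubini_tonelli_F _ _ _ _ _ P
  (fun p : T * T => phi (v + c * W k p.1 - e * Y k p.2))) => //.
apply: (measurableT_comp mphi); apply: measurable_funB => //.
  apply: measurable_funD => //; apply: measurable_funM => //.
  exact: measurableT_comp.
by apply: measurable_funM => //; exact: measurableT_comp.
Qed.

Lemma le_one_step k (phi psi : R -> \bar R) v :
  measurable_fun setT phi -> measurable_fun setT psi ->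
  (forall u, (0 <= phi u)%E) -> (forall u, (phi u <= psi u)%E) ->
  (one_step k phi v <= one_step k psi v)%E.
Proof.
move=> mphi mpsi phi0 phipsi.
have psi0 u : (0 <= psi u)%E := le_trans (phi0 u) (phipsi u).
apply: ge0_le_integral => //.
- by move=> w1 _; apply: integral_ge0.
- exact: measurable_mean_after_claim.
- exact: measurable_mean_after_claim.
- move=> w1 _; apply: ge0_le_integral => //.
  + exact: measurable_after_claim.
  + exact: measurable_after_claim.
Qed.

(** Exponentials turn the sum of the frozen surplus, the premium and the claim
    into a product. *)
Lemma one_step_exp k (r l m v : R) :
  (\int[P]_w (expR (- (r * (c * W k w))))%:E = l%:E)%E ->
  (\int[P]_w (expR (r * (e * Y k w)))%:E = m%:E)%E ->
  one_step k (fun u => (expR (- (r * u)))%:E) v =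
  (expR (- (r * v)) * (l * m))%:E.
Proof.
move=> lE mE.
have mY : measurable_fun setT (fun w => (expR (r * (e * Y k w)))%:E).
  apply/measurable_EFinP; apply: measurableT_comp => //.
  by do 2 apply: measurable_funM => //.
have mW : measurable_fun setT (fun w => (expR (- (r * (c * W k w))))%:E).
  apply/measurable_EFinP; apply: measurableT_comp => //.
  apply: measurableT_comp => //.
  by do 2 apply: measurable_funM => //.
have inner w1 : (\int[P]_w2 (expR (- (r * (v + c * W k w1 - e * Y k w2))))%:E =
    (expR (- (r * v)) * m)%:E * (expR (- (r * (c * W k w1))))%:E)%E.
  rewrite (_ : (\int[P]_w2 _)%E = (\int[P]_w2
      ((expR (- (r * v)) * expR (- (r * (c * W k w1))))%:E *
       (expR (r * (e * Y k w2)))%:E))%E).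
    rewrite ge0_integralZl_EFin//.
    by rewrite mE -!EFinM; congr (_%:E); ring.
  apply: eq_integral => w2 _; rewrite -EFinM -!expRD; congr (expR _)%:E; ring.
have m0 := mean_expR_ge0 mE.
rewrite /one_step; under eq_integral => w1 _ do rewrite inner.
rewrite ge0_integralZl_EFin//; last by rewrite mulr_ge0// expR_ge0.
by rewrite lE -EFinM; congr (_%:E); ring.
Qed.

(** Lundberg's inequality: [exp(- r V_k)] is a supermartingale that is at
    least 1 on ruin. *)
Lemma ruin_le k (r l m : R) : 0 <= r ->
  (forall k, \int[P]_w (expR (- (r * (c * W k w))))%:E = l%:E)%E ->
  (forall k, \int[P]_w (expR (r * (e * Y k w)))%:E = m%:E)%E ->
  l * m <= 1 ->
  (P [set w | (V k w < 0)%R] <= (expR (- (r * x)))%:E)%E.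
Proof.
move=> r0 lE mE lm1.
pose phi (v : R) : \bar R := (expR (- (r * v)))%:E.
have mphi : measurable_fun setT phi.
  apply/measurable_EFinP; apply: measurableT_comp => //.
  by apply: measurableT_comp => //; apply: measurable_funM.
have phi0 v : (0 <= phi v)%E by rewrite lee_fin expR_ge0.
have phiV : (\int[P]_w phi (V k w) <= phi x)%E.
  elim: k => [|k IH]; first by rewrite integral_stopped0.
  apply: le_trans IH; rewrite -[leRHS]mul1e.
  apply: integral_stopped_decrease => //; first by move=> v _; rewrite mul1e.
  move=> v v0; rewrite (one_step_exp _ (lE k) (mE k)) mul1e lee_fin.
  by rewrite ler_piMr// expR_ge0.
have mk := measurable_ruined k.
apply: le_trans phiV; rewrite -[X in P X]setIT -integral_indic//.
apply: ge0_le_integral => //.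
- by apply/measurable_EFinP; exact: measurable_indic.
- by apply: (measurableT_comp mphi); exact: measurable_stopped.
- move=> w _; rewrite indicE lee_fin; case: (boolP (_ \in _)) => [|_].
    rewrite inE /= => Vk; rewrite -[leLHS]expR0 ler_expR oppr_ge0.
    by rewrite mulr_ge0_le0// ltW.
  exact: expR_ge0.
Qed.

(** The defect in the submartingale bound is the probability of having
    survived [k] claims, weighted by [exp(- r V_k)], which decays
    geometrically. *)
Lemma ruin_ge k (a s r l m : R) : 0 <= r <= s -> 0 <= a <= 1 ->
  (forall k, \int[P]_w (expR (- (r * (c * W k w))))%:E = l%:E)%E ->
  (forall k, \int[P]_w (expR (r * (e * Y k w)))%:E = m%:E)%E ->
  (forall k v, 0 <= v ->
     (ruin_penalty a s v <= one_step k (ruin_penalty a s) v)%E) ->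
  ((a * expR (- (s * x)) - (l * m) ^+ k)%R%:E <= P [set w | (V k w < 0)%R])%E.
Proof.
move=> /andP[r0 rs] /andP[a0 a1] lE mE gstep.
pose g := ruin_penalty a s.
pose h (v : R) : \bar R := (if v < 0 then 0 else expR (- (r * v)))%:E.
have mexp t : measurable_fun setT (fun v : R => expR (- (t * v))).
  apply: measurableT_comp => //.
  by apply: measurableT_comp => //; apply: measurable_funM.
have mg : measurable_fun setT g by exact: measurable_ruin_penalty.
have mh : measurable_fun setT h.
  by apply/measurable_EFinP; apply: measurable_fun_ifT => //;
    exact: measurable_fun_ltr.
have g0 v : (0 <= g v)%E by exact: ruin_penalty_ge0.
have h0 v : (0 <= h v)%E.
  by rewrite lee_fin; case: ifP => // _; rewrite expR_ge0.
have l0 := mean_expR_ge0 (lE 0).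
have m0 := mean_expR_ge0 (mE 0).
have lm0 : 0 <= l * m by rewrite mulr_ge0.
have mV j : measurable_fun setT (V j) := measurable_stopped W Y c e x j.
have hV : (\int[P]_w h (V k w) <= ((l * m) ^+ k)%:E)%E.
  elim: k => [|k IH].
    rewrite integral_stopped0 expr0 lee_fin; case: ifP => // _.
    by rewrite -[leRHS]expR0 ler_expR oppr_le0 mulr_ge0.
  rewrite exprS EFinM; apply: le_trans (lee_wpmul2l _ IH); last by
    rewrite lee_fin.
  apply: integral_stopped_decrease => //.
    by move=> v v0; rewrite /h v0 mule0.
  move=> v v0; rewrite {2}/h ltNge v0/= -EFinM mulrC.
  rewrite -(one_step_exp _ (lE k) (mE k)).
  apply: le_one_step => //; last first.
    by move=> u; rewrite lee_fin; case: ifP => // _; exact: expR_ge0.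
  by apply/measurable_EFinP.
have gV : (g x <= \int[P]_w g (V k w))%E.
  elim: k {hV} => [|k IH]; first by rewrite integral_stopped0.
  by apply: (le_trans IH); apply: integral_stopped_increase => //; exact: gstep.
have mk := measurable_ruined k.
(* Here [r <= s] and [a <= 1] make [h] dominate the survival part of [g]. *)
have le : (\int[P]_w g (V k w) <=
    P [set w | (V k w < 0)%R] + \int[P]_w h (V k w))%E.
  rewrite -[X in P X]setIT -integral_indic// -ge0_integralD//; last 2 first.
  - by apply/measurable_EFinP; exact: measurable_indic.
  - exact: (measurableT_comp mh (mV k)).
  apply: ge0_le_integral => //.
  - exact: (measurableT_comp mg (mV k)).
  - apply: emeasurable_funD; last exact: (measurableT_comp mh (mV k)).
    by apply/measurable_EFinP; exact: measurable_indic.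
  move=> w _; rewrite /g /ruin_penalty /h -EFinD lee_fin indicE.
  case: ltP => Vk; first by rewrite mem_set ?addr0.
  rewrite memNset /= ?add0r; last by apply/negP; rewrite -leNgt.
  rewrite -[leRHS]mul1r ler_pM ?expR_ge0// ler_expR lerN2.
  by rewrite ler_wpM2r.
have := le_trans (le_trans gV le) (leeD2l _ hV).
rewrite /g /ruin_penalty ltNge x0/= EFinB leeBlDr//.
Qed.

End ruin_bounds.

(** * Exponential distributions and exponential inequalities *)

Section exponential_laplace.
Context (R : realType).
Local Notation leb := (@lebesgue_measure R).

(** [p] is a version of the Radon-Nikodym derivative of [nu], as both have the
    same integral over every measurable set. *)
Lemma integral_density (nu : probability (measurableTypeR R) R) (p : R -> R)
    (f : R -> \bar R) :
  measurable_fun setT p -> (forall y, 0 <= p y) ->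
  (forall B, measurable B -> nu B = \int[leb]_(y in B) (p y)%:E)%E ->
  measurable_fun setT f -> (forall y, (0 <= f y)%E) ->
  (\int[nu]_y f y = \int[leb]_y (f y * (p y)%:E))%E.
Proof.
move=> mp p0 nuE mf f0.
have mpE D : measurable_fun D (EFin \o p).
  by apply: measurable_funTS; apply/measurable_EFinP.
have numu : nu `<< leb.
  apply/null_content_dominatesP => A mA A0; rewrite nuE//.
  under eq_integral => y _ do rewrite -[_%:E]gee0_abs ?lee_fin//.
  exact: (integral_abs_eq0 mA (mpE A) A0).
rewrite -(Radon_Nikodym_SigmaFinite.change_of_variables numu)//.
apply: ae_eq_integral => //.
- apply: emeasurable_funM => //.
  exact: measurable_int (Radon_Nikodym_SigmaFinite.f_integrable numu).
- exact: (emeasurable_funM mf (mpE _)).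
- apply: ae_eqe_mul2l; apply: integral_ae_eq => //.
  + exact: (Radon_Nikodym_SigmaFinite.f_integrable numu).
  + exact: mpE.
  + move=> E _ mE.
    by rewrite -nuE// -Radon_Nikodym_SigmaFinite.f_integral.
Qed.

(** Tilting the exponential density of rate [rate] by [exp (- s y)] gives, up
    to the factor [rate / (rate + s)], the one of rate [rate + s]. *)
Lemma exponential_laplace d (T : measurableType d) (P : probability T R)
    (W : {RV P >-> R}) (rate s : R) : 0 < rate -> 0 <= s ->
  (forall w, 0 < W w) ->
  (forall B : set R, measurable B ->
     distribution P W B = exponential_prob rate B) ->
  (\int[P]_w (expR (- (s * W w)))%:E = (rate / (rate + s))%:E)%E.
Proof.
move=> rate0 s0 W0 WE.
have rs0 : 0 < rate + s by rewrite ltr_wpDr.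
pose f (y : R) : \bar R := (expR (- (s * y)))%:E.
have mf : measurable_fun setT f.
  apply/measurable_EFinP; apply: measurableT_comp => //.
  by apply: measurableT_comp => //; apply: measurable_funM.
have f0 y : (0 <= f y)%E by rewrite lee_fin expR_ge0.
(* Lebesgue measure lives on another presentation of the Borel structure of
   [R], on which [W] has to be repackaged. *)
have mW : @measurable_fun _ _ T (measurableTypeR R) setT W.
  by move=> _ A mA; apply: (measurable_funPT W).
pose WM := isMeasurableFun.Build _ _ T (measurableTypeR R) (W : T -> R) mW.
pose W' : {RV P >-> measurableTypeR R} := HB.pack (W : T -> R) WM.
transitivity (\int[distribution P W']_y f y)%E.
  by rewrite (ge0_integral_distribution W' mf).
transitivity (\int[leb]_y (f y * (exponential_pdf rate y)%:E))%E.
  apply: (@integral_density (distribution P W')) => //.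
  - exact: measurable_exponential_pdf.
  - by move=> y; apply: exponential_pdf_ge0; exact: ltW.
transitivity (\int[leb]_y ((rate / (rate + s))%:E *
    (exponential_pdf (rate + s) y)%:E))%E.
  apply: eq_integral => y _; rewrite -!EFinM; congr (_%:E).
  have [y0|y0] := ltP y 0; first by rewrite !lt0_exponential_pdf ?mulr0.
  rewrite !exponential_pdfE// [RHS]mulrA divfK ?gt_eqF// mulrCA -expRD.
  by congr (_ * expR _); ring.
rewrite ge0_integralZl_EFin//.
- by rewrite integral_exponential_pdf// mule1.
- by move=> y _; rewrite lee_fin exponential_pdf_ge0// ltW.
- by apply/measurable_EFinP; exact: measurable_exponential_pdf.
- by rewrite divr_ge0// ltW.
Qed.

End exponential_laplace.

Section exp_bounds.
Context (R : realType).

Lemma expR_ge_taylor2 (z : R) : 0 <= z -> 1 + z + z ^+ 2 / 2 <= expR z.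
Proof.
move=> z0.
pose f (y : R) := expR y - (1 + y + y ^+ 2 / 2).
have df (y : R) : is_derive y 1 f (expR y - (1 + y)).
  rewrite /f; apply: is_derive_eq.
  by rewrite /GRing.scale/=; field.
have : f 0 <= f z.
  apply: (ger0_derive1_ndecry (a := 0)) => //.
  - by move=> y _; rewrite derive1E derive_val subr_ge0 expR_ge1Dx.
  - by apply: continuous_subspaceT => y;
      apply/differentiable_continuous/derivable1_diffP.
by rewrite /f expR0 expr0n/= mul0r !addr0 subrr subr_ge0.
Qed.

(** The difference of the two sides vanishes at 0, and its derivative is
    nonnegative because [expR y <= 1 + y + y ^+ 2 * expR y]; the latter is
    [1 - y <= expR (- y)] multiplied by [(1 + y) * expR y]. *)
Lemma expR_le_taylor2 (z : R) : 0 <= z ->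
  expR z <= 1 + z + z ^+ 2 / 2 + z ^+ 3 * expR z.
Proof.
move=> z0.
have quad (y : R) : 0 <= y -> expR y <= 1 + y + y ^+ 2 * expR y.
  move=> y0.
  have e2 : expR (- y) * expR y = 1 by rewrite -expRD addNr expR0.
  have : 0 <= (1 + y) * expR y * (expR (- y) - (1 + - y)).
    by rewrite mulr_ge0 ?subr_ge0 ?expR_ge1Dx// mulr_ge0 ?expR_ge0// addr_ge0.
  rewrite mulrBr -[X in X - _]mulrA (mulrC (expR y)) e2; lra.
pose f (y : R) := 1 + y + y ^+ 2 / 2 + y ^+ 3 * expR y - expR y.
have df (y : R) : is_derive y 1 f
    (1 + y + 3 * y ^+ 2 * expR y + y ^+ 3 * expR y - expR y).
  rewrite /f; apply: is_derive_eq.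
  by rewrite /GRing.scale/=; field.
have : f 0 <= f z.
  apply: (ger0_derive1_ndecry (a := 0)) => //.
  - move=> y; rewrite in_itv/= andbT => /ltW y0; rewrite derive1E derive_val.
    have := quad y y0.
    have : 0 <= y ^+ 2 * expR y by rewrite mulr_ge0 ?expR_ge0 ?exprn_ge0.
    have : 0 <= y ^+ 3 * expR y by rewrite mulr_ge0 ?expR_ge0 ?exprn_ge0.
    by rewrite -!mulrA; lra.
  - by apply: continuous_subspaceT => y;
      apply/differentiable_continuous/derivable1_diffP.
rewrite /f expR0 !expr0n/= !mul0r !addr0 subrr; lra.
Qed.

End exp_bounds.

(** * Exponential moments of the claims *)

Section claim_estimates.
Context d (T : measurableType d) (R : realType) (P : probability T R).

(** The exponential inequalities are integrated pointwise. The cubic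
    remainder has a finite mean because [X w ^+ 3] is absorbed by one half of
    the available exponential moment and [expR (s * X w)] by the other half,
    which is why [s] stops at [t / 2]. *)
Lemma mgf_taylor_ge0 (X : T -> R) (t : R) :
  measurable_fun setT X -> (forall w, 0 <= X w) -> 0 < t ->
  (\int[P]_w (expR (t * X w))%:E < +oo)%E ->
  exists m1 m2 C : R,
  [/\ (\int[P]_w (X w)%:E = m1%:E)%E, (\int[P]_w (X w ^+ 2)%:E = m2%:E)%E,
      0 <= C &
      forall s, 0 <= s <= t / 2 -> exists m : R,
        (\int[P]_w (expR (s * X w))%:E = m%:E)%E /\
        1 + s * m1 + s ^+ 2 * m2 / 2 <= m <=
        1 + s * m1 + s ^+ 2 * m2 / 2 + C * s ^+ 3].
Proof.
move=> mX X0 t0 fin.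
have mexp s : measurable_fun setT (fun w => (expR (s * X w))%:E).
  apply/measurable_EFinP; apply: measurableT_comp => //.
  exact: measurable_funM.
have mX1 : measurable_fun setT (fun w => (X w)%:E) by apply/measurable_EFinP.
have mX2 : measurable_fun setT (fun w => (X w ^+ 2)%:E).
  by apply/measurable_EFinP; apply: measurable_funX.
have I0 (f : T -> R) : (forall w, 0 <= f w) -> (0 <= \int[P]_w (f w)%:E)%E.
  by move=> f0; apply: integral_ge0 => w _; rewrite lee_fin.
have fine_int (f : T -> R) (k : R) : measurable_fun setT (EFin \o f) ->
    (forall w, 0 <= f w) -> 0 <= k ->
    (forall w, f w <= k * expR (t * X w)) ->
    (\int[P]_w (f w)%:E = (fine (\int[P]_w (f w)%:E))%:E)%E.
  move=> mf f0 k0 fk; rewrite fineK// ge0_fin_numE; last exact: I0.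
  apply: (@le_lt_trans _ _ (k%:E * \int[P]_w (expR (t * X w))%:E)%E).
    rewrite -ge0_integralZl_EFin//.
    apply: ge0_le_integral => //.
    - by move=> w _; rewrite lee_fin.
    - exact: measurable_funeM.
    - by move=> w _; rewrite -EFinM lee_fin.
  by rewrite lte_mul_pinfty.
pose m1 := fine (\int[P]_w (X w)%:E)%E.
pose m2 := fine (\int[P]_w (X w ^+ 2)%:E)%E.
pose B := fine (\int[P]_w (expR (t * X w))%:E)%E.
have tX w : 0 <= t * X w by rewrite mulr_ge0// ltW.
have m1E : (\int[P]_w (X w)%:E = m1%:E)%E.
  apply: (fine_int _ t^-1) => //; first by rewrite invr_ge0 ltW.
  move=> w; rewrite mulrC ler_pdivlMr// mulrC.
  by apply: le_trans (expR_ge1Dx _); rewrite lerDr.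
have m2E : (\int[P]_w (X w ^+ 2)%:E = m2%:E)%E.
  apply: (fine_int _ (2 / t ^+ 2)) => //.
  - by move=> w; rewrite exprn_ge0.
  - by rewrite divr_ge0// exprn_ge0// ltW.
  move=> w; rewrite mulrAC ler_pdivlMr ?exprn_gt0// -exprMn mulrC.
  have := expR_ge_taylor2 (tX w); have := tX w; lra.
have BE : (\int[P]_w (expR (t * X w))%:E = B%:E)%E.
  apply: (fine_int _ 1 (mexp t)) => // w; rewrite ?expR_ge0 ?mul1r//.
have B0 : 0 <= B by rewrite -lee_fin -BE; apply: I0 => w; exact: expR_ge0.
pose C := 6 / (t / 2) ^+ 3 * B.
have t20 : 0 < t / 2 by rewrite divr_gt0.
exists m1, m2, C; split => //.
  by rewrite mulr_ge0// divr_ge0// exprn_ge0// ltW.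
move=> s /andP[s0 st].
(* [p] is the quadratic Taylor polynomial, with mean [1 + s m1 + s^2 m2 / 2]. *)
pose p w := 1 + s * X w + s ^+ 2 / 2 * X w ^+ 2.
have p0 w : 0 <= p w.
  by rewrite !addr_ge0// ?mulr_ge0// ?exprn_ge0.
have mp : measurable_fun setT (fun w => (p w)%:E).
  apply/measurable_EFinP; apply: measurable_funD; last first.
    by apply: measurable_funM => //; apply: measurable_funX.
  by apply: measurable_funD => //; apply: measurable_funM.
have pE : (\int[P]_w (p w)%:E = (1 + s * m1 + s ^+ 2 * m2 / 2)%:E)%E.
  transitivity (\int[P]_w (1%:E + s%:E * (X w)%:E +
    (s ^+ 2 / 2)%:E * (X w ^+ 2)%:E))%E => //.
  rewrite ge0_integralD//; last 4 first.
  - by move=> w _; rewrite lee_fin addr_ge0// mulr_ge0.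
  - apply: emeasurable_funD => //; exact: measurable_funeM.
  - by move=> w _; rewrite lee_fin mulr_ge0 ?exprn_ge0// mulr_ge0// exprn_ge0.
  - exact: measurable_funeM.
  rewrite ge0_integralD//; last 2 first.
  - by move=> w _; rewrite lee_fin mulr_ge0.
  - exact: measurable_funeM.
  rewrite integral_cst//= probability_setT mule1.
  rewrite ge0_integralZl_EFin//; last by move=> w _; rewrite lee_fin.
  rewrite ge0_integralZl_EFin//; last 2 first.
  - by move=> w _; rewrite lee_fin exprn_ge0.
  - by rewrite mulr_ge0// exprn_ge0.
  by rewrite m1E m2E -!EFinM -!EFinD; congr (_%:E); ring.
have lo w : p w <= expR (s * X w).
  have := @expR_ge_taylor2 R (s * X w); rewrite mulr_ge0// => /(_ isT).
  by rewrite /p exprMn; apply: le_trans; lra.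
have hi w : expR (s * X w) <= p w + 6 / (t / 2) ^+ 3 * s ^+ 3 * expR (t * X w).
  have := @expR_le_taylor2 R (s * X w); rewrite mulr_ge0// => /(_ isT) H.
  apply: (le_trans H); rewrite /p exprMn; apply: lerD; first lra.
  have X3 : X w ^+ 3 <= 6 / (t / 2) ^+ 3 * expR (t / 2 * X w).
    rewrite mulrAC ler_pdivlMr ?exprn_gt0// -exprMn mulrC.
    have := @expR_ge1Dxn R (t / 2 * X w) 2;
      rewrite (mulr_ge0 (ltW t20) (X0 w)) => /(_ isT).
    have -> : 3`!%:R = 6 :> R by [].
    lra.
  have st' : expR (s * X w) <= expR (t / 2 * X w) by rewrite ler_expR ler_wpM2r.
  move: (6 / (t / 2) ^+ 3) X3 => c X3.
  rewrite exprMn -[leLHS]mulrA [leRHS](_ : _ = s ^+ 3 * (c * expR (t * X w)));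
    last by ring.
  apply: ler_wpM2l; first by rewrite exprn_ge0.
  apply: (le_trans (ler_pM _ _ X3 st')); rewrite ?exprn_ge0 ?expR_ge0//.
  by rewrite -[leLHS]mulrA -expRD -mulrDl -splitr.
have mE : (\int[P]_w (expR (s * X w))%:E =
    (fine (\int[P]_w (expR (s * X w))%:E))%:E)%E.
  apply: (fine_int _ 1 (mexp s)) => // w; rewrite ?expR_ge0//.
  rewrite mul1r ler_expR ler_wpM2r//; apply: le_trans st _; lra.
set m := fine _ in mE.
exists m; split => //; rewrite -!lee_fin -mE -pE; apply/andP; split.
  apply: ge0_le_integral => //; by move=> w _; rewrite lee_fin.
rewrite EFinD -pE.
have -> : (C * s ^+ 3)%:E =
    (\int[P]_w ((6 / (t / 2) ^+ 3 * s ^+ 3)%:E * (expR (t * X w))%:E))%E.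
  rewrite ge0_integralZl_EFin//.
    by rewrite BE -EFinM /C; congr (_%:E); ring.
  by rewrite mulr_ge0 ?exprn_ge0// divr_ge0// exprn_ge0// ltW.
have k0 : 0 <= 6 / (t / 2) ^+ 3 * s ^+ 3.
  by rewrite mulr_ge0 ?exprn_ge0// divr_ge0// exprn_ge0// ltW.
rewrite -ge0_integralD//; last 3 first.
- by move=> w _; rewrite lee_fin.
- by move=> w _; rewrite lee_fin mulr_ge0// expR_ge0.
- exact: measurable_funeM.
apply: ge0_le_integral => //.
- apply: emeasurable_funD => //; exact: measurable_funeM.
- by move=> w _; rewrite -EFinM -EFinD lee_fin.
Qed.

End claim_estimates.

Section claims.
Context d (T : measurableType d) (R : realType) (P : probability T R).

Lemma integral_same_distribution (X Y : {RV P >-> R}) (phi : R -> \bar R) :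
  same_distribution P X Y -> measurable_fun setT phi ->
  (forall v, (0 <= phi v)%E) ->
  (\int[P]_w phi (X w) = \int[P]_w phi (Y w))%E.
Proof.
move=> XY mphi phi0.
rewrite -(ge0_integral_distribution X mphi)// -(ge0_integral_distribution Y mphi)//.
by apply: eq_measure_integral => A mA _; exact: XY.
Qed.

(** Otherwise [f] would vanish almost everywhere, while it is positive almost
    everywhere; both cannot hold on a set of probability 1. *)
Lemma integral_gt0 (f : T -> R) : measurable_fun setT f ->
  (forall w, 0 <= f w) -> {ae P, forall w, 0 < f w} ->
  (0 < \int[P]_w (f w)%:E)%E.
Proof.
move=> mf f0 ae_f; rewrite lt_neqAle; apply/andP; split; last first.
  by apply: integral_ge0 => w _; rewrite lee_fin.
apply/negP => /eqP I0.
have : (\int[P]_w `|(f w)%:E| = 0)%E.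
  by rewrite I0; apply: eq_integral => w _; rewrite gee0_abs// lee_fin.
move/(ae_eq_integral_abs P measurableT (iffRL (measurable_EFinP _ _) mf)) => ae0.
have : {ae P, forall w : T, False}.
  apply: filterS2 ae_f ae0 => w fw /(_ I) /= -[fw0].
  by rewrite fw0 ltxx in fw.
move=> [A [mA PA sub]].
have : P setT = 0%E.
  by apply: (subset_measure0 _ mA _ PA) => // w _; apply: sub.
by rewrite probability_setT => /eqP; rewrite onee_eq0.
Qed.

(** The claim is only almost surely positive, so it is first replaced by its
    positive part, which changes none of the integrals. *)
Lemma mgf_taylor (Y : {RV P >-> R}) : {ae P, forall w, 0 < Y w} ->
  (exists2 u0 : R, 0 < u0 & forall u : R, `|u| < u0 -> ('M_P Y u < +oo)%E) ->
  exists t C : R,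
  [/\ 0 < t, 0 <= C, 0 < mean_claim P Y, 0 < mean_sq_claim P Y &
      forall s, 0 <= s <= t -> exists m : R,
        (\int[P]_w (expR (s * Y w))%:E = m%:E)%E /\
        1 + s * mean_claim P Y + s ^+ 2 * mean_sq_claim P Y / 2 <= m <=
        1 + s * mean_claim P Y + s ^+ 2 * mean_sq_claim P Y / 2 + C * s ^+ 3].
Proof.
move=> Y0 [u0 u00 mgf].
pose X w := Num.max (Y w) 0.
have mX : measurable_fun setT X by apply: measurable_maxr.
have X0 w : 0 <= X w by rewrite le_max lexx orbT.
have XY : {ae P, forall w, X w = Y w}.
  by apply: filterS Y0 => w /ltW Yw; rewrite /X; apply/max_idPl.
have XE (phi : R -> R) : measurable_fun setT phi ->
    (\int[P]_w (phi (Y w))%:E = \int[P]_w (phi (X w))%:E)%E.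
  move=> mphi; apply: ae_eq_integral => //.
  - by apply/measurable_EFinP; apply: measurableT_comp.
  - by apply/measurable_EFinP; apply: measurableT_comp.
  - by apply: filterS XY => w -> _.
have mexp s : measurable_fun setT (fun y : R => expR (s * y)).
  by apply: measurableT_comp => //; apply: measurable_funM.
have t0 : 0 < u0 / 2 by rewrite divr_gt0.
have fin : (\int[P]_w (expR (u0 / 2 * X w))%:E < +oo)%E.
  rewrite -(XE (fun y => expR (u0 / 2 * y)))//.
  have := mgf (u0 / 2); rewrite gtr0_norm// ltr_pdivrMr// ltr_pMr// ltr1n.
  move=> /(_ isT); rewrite /mmt_gen_fun unlock; congr (_ < _)%E.
  by apply: eq_integral => w _ /=; rewrite mulrC.
have [m1 [m2 [C [m1E m2E C0 taylor]]]] := mgf_taylor_ge0 mX X0 t0 fin.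
have mc : mean_claim P Y = m1.
  by rewrite /mean_claim unlock (XE id)//= m1E.
have msc : mean_sq_claim P Y = m2.
  by rewrite /mean_sq_claim unlock (XE (fun y => y ^+ 2))//= ?m2E.
have aeX : {ae P, forall w, 0 < X w} by apply: filterS2 XY Y0 => w ->.
exists (u0 / 2 / 2), C; split; rewrite ?mc ?msc//.
- by rewrite divr_gt0.
- by rewrite -lte_fin -m1E; apply: integral_gt0.
- rewrite -lte_fin -m2E; apply: integral_gt0.
  + exact: measurable_funX.
  + by move=> w; rewrite exprn_ge0.
  + by apply: filterS aeX => w Xw; rewrite exprn_gt0.
move=> s /taylor[m [mE mb]]; exists m; split => //.
by rewrite (XE (fun y => expR (s * y))).
Qed.

(** For an overshoot [z > 0] and [s <= kappa],
    [expR (s * z) <= 1 + s * z * expR (s * z)], and the last factor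
    [z * expR (s * z)] is at most [z ^+ 2 * expR (kappa * z) + expR kappa].
    The mean of the square term is bounded uniformly in the level by the
    moment condition, so the mean exponential overshoot is [1 + O (s)]. *)
Lemma overshoot (Y : {RV P >-> R}) (kappa : R) : 0 <= kappa ->
  (ereal_sup
     [set cond_expectation P
            (fun w => ((Y w - d0) ^+ 2 * expR (kappa * (Y w - d0)))%R)
            [set w | (d0 < Y w)%R]
     | d0 in [set d0 : R | (0 <= d0)%R /\ (0 < P [set w | (d0 < Y w)%R])%E]]
   < +oo)%E ->
  exists2 A : R, 0 <= A & forall s d0 : R, 0 <= s <= kappa -> 0 <= d0 ->
    (\int[P]_(w in [set w | (d0 < Y w)%R]) (expR (s * (Y w - d0)))%:E
      <= (1 + s * A)%:E * P [set w | (d0 < Y w)%R])%E.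
Proof.
move=> k0; set S := ereal_sup _ => Soo.
have mtail d0 : measurable [set w | d0 < Y w].
  have -> : [set w | d0 < Y w] = Y @^-1` `]d0, +oo[%classic.
    by apply/seteqP; split => w /=; rewrite in_itv/= andbT.
  by rewrite -[_ @^-1` _]setTI; exact: measurable_funPT.
have mexp s d0 : measurable_fun setT (fun w => expR (s * (Y w - d0))).
  by apply: measurableT_comp => //; apply: measurable_funM => //;
    apply: measurable_funB.
have mF d0 : measurable_fun setT
    (fun w => (Y w - d0) ^+ 2 * expR (kappa * (Y w - d0))).
  by apply: measurable_funM => //; apply: measurable_funX;
    apply: measurable_funB.
have F0 d0 w : 0 <= (Y w - d0) ^+ 2 * expR (kappa * (Y w - d0)).
  by rewrite mulr_ge0 ?expR_ge0// sqr_ge0.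
pose A0 := Num.max 0 (fine S).
have A00 : 0 <= A0 by rewrite le_max lexx.
have second d0 : 0 <= d0 ->
    (\int[P]_(w in [set w | (d0 < Y w)%R])
      ((Y w - d0) ^+ 2 * expR (kappa * (Y w - d0)))%:E
      <= A0%:E * P [set w | (d0 < Y w)%R])%E.
  move=> d00; have [p0|p0] := eqVneq (P [set w | d0 < Y w]) 0%E.
    rewrite p0 mule0 (_ : integral _ _ _ = 0%E)//.
    under eq_integral => w _ do rewrite -[_%:E]gee0_abs ?lee_fin//.
    apply: integral_abs_eq0 => //.
    by apply: measurable_funTS; apply/measurable_EFinP.
  have pgt0 : (0 < P [set w | (d0 < Y w)%R])%E by rewrite lt0e p0/=.
  have pfin : P [set w | d0 < Y w] \is a fin_num by apply: fin_num_measure.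
  have fpgt0 : 0 < fine (P [set w | d0 < Y w]).
    by rewrite fine_gt0// pgt0 -ge0_fin_numE.
  set I := (\int[P]_(w in _) _)%E.
  have I0 : (0 <= I)%E by apply: integral_ge0 => w _; rewrite lee_fin.
  have IS : (I * ((fine (P [set w | d0 < Y w]))^-1)%:E <= S)%E.
    by apply: ereal_sup_ubound; exists d0.
  have S0 : (0 <= S)%E.
    by apply: le_trans IS; rewrite mule_ge0// lee_fin invr_ge0 ltW.
  have SA : (S <= A0%:E)%E.
    rewrite -(@fineK _ S); last by rewrite ge0_fin_numE.
    by rewrite lee_fin le_max lexx orbT.
  rewrite -[P _](fineK pfin).
  by rewrite -lee_pdivrMr//; apply: le_trans SA.
exists (A0 + expR kappa); first by rewrite addr_ge0 ?expR_ge0.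
move=> s d0 /andP[s0 sk] d00.
have mD := mtail d0.
rewrite mulrDr addrA addrAC EFinD muleDl ?fin_num_measure ?fin_num_adde_defr//.
have -> : ((1 + s * expR kappa)%:E * P [set w | (d0 < Y w)%R] =
    \int[P]_(w in [set w | (d0 < Y w)%R]) (cst (1 + s * expR kappa)%:E w))%E.
  by rewrite integral_cst.
apply: (@le_trans _ _ (\int[P]_(w in [set w | (d0 < Y w)%R])
   ((1 + s * expR kappa)%:E +
    s%:E * ((Y w - d0) ^+ 2 * expR (kappa * (Y w - d0)))%:E))%E).
  apply: ge0_le_integral => //.
  - by apply: measurable_funTS; apply/measurable_EFinP.
  - by apply: measurable_funTS; apply: emeasurable_funD => //;
      apply: measurable_funeM; apply/measurable_EFinP.
  move=> w /= dY; rewrite -EFinM -EFinD lee_fin.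
  move: dY; rewrite -subr_gt0; move: (Y w - d0) => z z0.
  have e1 : expR (s * z) <= 1 + s * z * expR (s * z).
    have H := expR_ge1Dx (- (s * z)).
    have e2 : expR (- (s * z)) * expR (s * z) = 1 by rewrite -expRD addNr expR0.
    have := ler_wpM2r (expR_ge0 (s * z)) H; rewrite e2; lra.
  have e3 : z * expR (s * z) <= z ^+ 2 * expR (kappa * z) + expR kappa.
    apply: (@le_trans _ _ (z * expR (kappa * z))).
      by rewrite ler_pM2l// ler_expR ler_pM2r.
    have [z1|z1] := leP z 1.
      apply: (@le_trans _ _ (expR kappa)).
        rewrite -[leRHS]mul1r; apply: ler_pM => //; first exact: ltW.
        by rewrite ler_expR -[leRHS]mulr1 ler_wpM2l.
      by rewrite lerDr mulr_ge0 ?expR_ge0// sqr_ge0.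
    rewrite -[leLHS]addr0 lerD ?expR_ge0// ler_wpM2r ?expR_ge0// expr2.
    by rewrite ler_pMr// ltW.
  have := ler_wpM2l s0 e3; rewrite mulrA; lra.
rewrite ge0_integralD//; last 3 first.
- by move=> w _; rewrite lee_fin addr_ge0// mulr_ge0// expR_ge0.
- by move=> w _; rewrite mule_ge0 ?lee_fin.
- by apply: measurable_funTS; apply: measurable_funeM; apply/measurable_EFinP.
rewrite leeD2l// ge0_integralZl_EFin//; last 2 first.
- by move=> w _; rewrite lee_fin.
- by apply: measurable_funTS; apply/measurable_EFinP.
by rewrite EFinM -muleA; apply: lee_wpmul2l; [rewrite lee_fin|exact: second].
Qed.

End claims.

(** * The submartingale of the lower bound *)

Section subsolution.
Context d (T : measurableType d) (R : realType) (P : probability T R).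

(** Where the claim does not ruin, the penalty equals the exponential. Where it
    does, the penalty is 1 while the exponential is [a] times the exponential
    of the overshoot, whose integral is at most the probability of ruin by the
    choice of [a]. *)
Lemma claim_subsolution (Y : {RV P >-> R}) (e r A u m : R) :
  0 < e -> 0 <= r -> 0 <= A ->
  (\int[P]_w (expR (r * (e * Y w)))%:E = m%:E)%E ->
  (\int[P]_(w in [set w | (u / e < Y w)%R]) (expR (r * e * (Y w - u / e)))%:E
      <= (1 + r * e * A)%:E * P [set w | (u / e < Y w)%R])%E ->
  forall a, a = (1 + r * e * A)^-1 ->
  ((a * expR (- (r * u)) * m)%:E <=
    \int[P]_w ruin_penalty a r (u - e * Y w)%R)%E.
Proof.
move=> e0 r0 A0 mE ov a aE.
have k0 : 0 < 1 + r * e * A by rewrite ltr_wpDr// mulr_ge0// mulr_ge0// ltW.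
have a0 : 0 < a by rewrite aE invr_gt0.
pose f (w : T) : \bar R := (a * expR (- (r * (u - e * Y w))))%:E.
have mf : measurable_fun setT f.
  apply/measurable_EFinP; apply: measurable_funM => //.
  apply: measurableT_comp => //; apply: measurableT_comp => //.
  apply: measurable_funM => //; apply: measurable_funB => //.
  exact: measurable_funM.
have f0 w : (0 <= f w)%E by rewrite lee_fin mulr_ge0 ?expR_ge0// ltW.
pose h (w : T) := ruin_penalty a r (u - e * Y w).
have mh : measurable_fun setT h.
  apply: (measurableT_comp (measurable_ruin_penalty a r)).
  by apply: measurable_funB => //; apply: measurable_funM.
have h0 w : (0 <= h w)%E by apply: ruin_penalty_ge0; exact: ltW.
have fE : (\int[P]_w f w = (a * expR (- (r * u)) * m)%:E)%E.
  rewrite EFinM -mE -ge0_integralZl_EFin//.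
  - apply: eq_integral => w _; rewrite /f -EFinM -mulrA -expRD.
    by congr (_ * expR _)%:E; ring.
  - apply/measurable_EFinP; apply: measurableT_comp => //.
    by apply: measurable_funM => //; apply: measurable_funM.
  - by rewrite mulr_ge0 ?expR_ge0// ltW.
rewrite -fE -[leRHS]/(\int[P]_w h w)%E.
pose D := [set w | u / e < Y w].
have mD : measurable D.
  have -> : D = Y @^-1` `]u / e, +oo[%classic.
    by apply/seteqP; split => w /=; rewrite in_itv/= andbT.
  by rewrite -[_ @^-1` _]setTI; exact: measurable_funPT.
have DE w : (u - e * Y w < 0) = (u / e < Y w).
  by rewrite subr_lt0 ltr_pdivrMr// mulrC.
rewrite -(setUv D) !ge0_integral_setU//; try (by
  [exact: measurableC|rewrite setUv|apply/disj_setPCl|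
   move=> ? _; exact: f0|move=> ? _; exact: h0]).
apply: leeD.
  have -> : (\int[P]_(w in D) h w = P D)%E.
    rewrite -[RHS]mul1e -integral_cst//; apply: eq_integral => w.
    by rewrite inE /= => Dw; rewrite /h /ruin_penalty DE Dw.
  apply: (@le_trans _ _ (a%:E * ((1 + r * e * A)%:E * P D))%E).
    apply: le_trans (lee_wpmul2l _ ov); last by rewrite lee_fin ltW.
    rewrite -ge0_integralZl_EFin//.
    - apply: ge0_le_integral => //.
      + by apply: measurable_funTS.
      + apply: measurable_funTS; apply: measurable_funeM.
        apply/measurable_EFinP; apply: measurableT_comp => //.
        by apply: measurable_funM => //; apply: measurable_funB.
      + move=> w _; rewrite -EFinM lee_fin ler_pM2l// ler_expR.
        rewrite le_eqVlt; apply/orP; left; apply/eqP; field.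
        by rewrite gt_eqF.
    - apply: measurable_funTS.
      apply/measurable_EFinP; apply: measurableT_comp => //.
      by apply: measurable_funM => //; apply: measurable_funB.
    - exact: ltW.
  by rewrite muleA -EFinM aE mulVf ?gt_eqF// mul1e.
apply: ge0_le_integral => //.
- exact: measurableC.
- by apply: measurable_funTS.
- by apply: measurable_funTS.
- by move=> w /= Dw; rewrite /f /h /ruin_penalty DE (negbTE (introN idP Dw)).
Qed.

(** [claim_subsolution] is applied with the surplus just before the claim
    frozen, and averaging over the interarrival time gives the factor
    [l * m >= 1]. *)
Lemma one_step_subsolution (W Y : nat -> {RV P >-> R}) (c e r A l m : R) :
  (forall k w, 0 < W k w) -> 0 <= c ->
  0 < e -> 0 <= r -> 0 <= A ->
  (forall k, \int[P]_w (expR (- (r * (c * W k w))))%:E = l%:E)%E ->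
  (forall k, \int[P]_w (expR (r * (e * Y k w)))%:E = m%:E)%E ->
  (forall k d0, 0 <= d0 ->
    (\int[P]_(w in [set w | (d0 < Y k w)%R]) (expR (r * e * (Y k w - d0)))%:E
      <= (1 + r * e * A)%:E * P [set w | (d0 < Y k w)%R])%E) ->
  1 <= l * m ->
  let a := (1 + r * e * A)^-1 in
  forall k v, 0 <= v ->
    (ruin_penalty a r v <= one_step W Y c e k (ruin_penalty a r) v)%E.
Proof.
move=> W0 c0 e0 r0 A0 lE mE ov lm a k v v0.
have k0 : 0 < 1 + r * e * A by rewrite ltr_wpDr// mulr_ge0// mulr_ge0// ltW.
have a0 : 0 < a by rewrite invr_gt0.
have m0 := mean_expR_ge0 (mE 0).
have mg := measurable_ruin_penalty a r.
have g0 u : (0 <= ruin_penalty a r u)%E by apply: ruin_penalty_ge0; exact: ltW.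
have mW : measurable_fun setT (fun w => (expR (- (r * (c * W k w))))%:E).
  apply/measurable_EFinP; apply: measurableT_comp => //.
  apply: measurableT_comp => //.
  by do 2 apply: measurable_funM => //.
have k1 : 0 <= a * expR (- (r * v)) * m.
  by rewrite !mulr_ge0 ?expR_ge0// ltW.
apply: (@le_trans _ _ (\int[P]_w1 ((a * expR (- (r * v)) * m)%:E *
    (expR (- (r * (c * W k w1))))%:E))%E).
  rewrite ge0_integralZl_EFin// lE -EFinM lee_fin /ruin_penalty ltNge v0/=.
  rewrite -[leLHS]mulr1 -[leRHS]mulrA (mulrC m); apply: ler_wpM2l => //.
  by rewrite mulr_ge0 ?expR_ge0// ltW.
apply: ge0_le_integral => //.
- by move=> w _; rewrite mule_ge0 ?lee_fin.
- by apply: measurable_funeM.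
- exact: measurable_mean_after_claim.
move=> w1 _.
have u0 : 0 <= v + c * W k w1 by rewrite addr_ge0// mulr_ge0// ltW.
have := claim_subsolution e0 r0 A0 (mE k)
  (ov k _ (divr_ge0 u0 (ltW e0))) erefl.
apply: le_trans; rewrite -EFinM lee_fin -/a.
by rewrite mulrDr opprD expRD mulrAC !mulrA.
Qed.

End subsolution.

Section pathwise.
Context d (T : measurableType d) (R : realType) (P : probability T R).
Variables (W Y : nat -> {RV P >-> R}) (c q x : R).

Let jump_surplus k w := x + c * (\sum_(i < k) W i w) - \sum_(i < k) Y i w / q.

Let stopped_cases k w :
  stopped W Y c q^-1 x k w = jump_surplus k w \/
  (exists j, jump_surplus j w < 0) /\ stopped W Y c q^-1 x k w < 0.
Proof.
elim: k => [|k IH] /=; first by left; rewrite /jump_surplus !big_ord0; ring.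
have [neg|pos] := ltP (stopped W Y c q^-1 x k w) 0.
  by right; split => //; case: IH => [E|[]//]; exists k; rewrite -E.
case: IH => [->|[_]]; last by rewrite ltNge pos.
by left; rewrite /jump_surplus !big_ord_recr/=; ring.
Qed.

(** Between claims the surplus increases, so the surplus at time [t] is at
    least the one just after the last claim before [t]. *)
Lemma ruin_at_claims (N : R -> T -> nat) w : 0 <= c ->
  (forall k, 0 < W k w) ->
  (forall (t : R) (k : nat), 0 <= t ->
     (k <= N t w)%N <-> \sum_(i < k) W i w <= t) ->
  (exists2 t, 0 <= t & x + c * t - \sum_(i < N t w) Y i w / q < 0) <->
  (exists k, stopped W Y c q^-1 x k w < 0).
Proof.
move=> c0 W0 NW; split.
  move=> [t t0 neg].
  suff : exists k, jump_surplus k w < 0.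
    move=> [k]; case: (stopped_cases k w) => [<-|[_]] ?; by exists k.
  exists (N t w); apply: le_lt_trans neg.
  rewrite lerD2r lerD2l ler_wpM2l//.
  exact/(NW _ _ t0).
suff : (exists k, jump_surplus k w < 0) ->
    exists2 t, 0 <= t & x + c * t - \sum_(i < N t w) Y i w / q < 0.
  move=> H [k]; case: (stopped_cases k w) => [->|[ex _ _]]; last exact: H.
  by move=> neg; apply: H; exists k.
move=> [k neg]; exists (\sum_(i < k) W i w).
  by apply: sumr_ge0 => i _; exact: ltW.
have t0 : 0 <= \sum_(i < k) W i w by apply: sumr_ge0 => i _; exact: ltW.
suff -> : N (\sum_(i < k) W i w) w = k by exact: neg.
apply/eqP; rewrite eqn_leq; apply/andP; split; last exact/(NW _ _ t0).
rewrite leqNgt; apply/negP => /(NW _ _ t0).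
by rewrite big_ord_recr/= gerDl leNgt W0.
Qed.

End pathwise.

(** * Ultimate ruin *)

Section infinite_horizon.
Context d (T : measurableType d) (R : realType) (P : probability T R).
Variables (W Y : nat -> {RV P >-> R}) (c e x : R).
Hypothesis indep :
  mutually_independent P (fun i => (sum_family W Y i : T -> R)).
Hypothesis x0 : 0 <= x.

Local Notation ruined k := [set w | stopped W Y c e x k w < 0].

Let mruined k : measurable (ruined k) := measurable_ruined W Y c e x k.

Lemma measurable_ever_ruined : measurable (\bigcup_k ruined k).
Proof. exact: bigcup_measurable. Qed.

Let ruined_cvg : P (ruined k) @[k --> \oo] --> P (\bigcup_k ruined k).
Proof.
apply: nondecreasing_cvg_mu => //; first exact: measurable_ever_ruined.
by apply/nondecreasing_seqP => k; apply/subsetPset => w /= neg; rewrite neg.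
Qed.

Lemma ever_ruined_le (r l m : R) : 0 <= r ->
  (forall k, \int[P]_w (expR (- (r * (c * W k w))))%:E = l%:E)%E ->
  (forall k, \int[P]_w (expR (r * (e * Y k w)))%:E = m%:E)%E ->
  l * m <= 1 ->
  (P (\bigcup_k ruined k) <= (expR (- (r * x)))%:E)%E.
Proof.
move=> r0 lE mE lm1; rewrite -(cvg_lim _ ruined_cvg)//.
apply: lime_le; first by apply: cvgP ruined_cvg.
by apply: nearW => k; apply: ruin_le lE mE lm1.
Qed.

(** The bound after [k] claims has an error [(l * m) ^+ k], which vanishes in
    the limit. *)
Lemma ever_ruined_ge (a s r l m : R) : 0 <= r <= s -> 0 <= a <= 1 ->
  (forall k, \int[P]_w (expR (- (r * (c * W k w))))%:E = l%:E)%E ->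
  (forall k, \int[P]_w (expR (r * (e * Y k w)))%:E = m%:E)%E ->
  l * m < 1 ->
  (forall k v, 0 <= v ->
     (ruin_penalty a s v <= one_step W Y c e k (ruin_penalty a s) v)%E) ->
  ((a * expR (- (s * x)))%:E <= P (\bigcup_k ruined k))%E.
Proof.
move=> rs a01 lE mE lm1 gstep.
have mU := measurable_ever_ruined.
have l0 := mean_expR_ge0 (lE 0).
have m0 := mean_expR_ge0 (mE 0).
have pfin : P (\bigcup_k ruined k) \is a fin_num by apply: fin_num_measure.
rewrite -[leRHS](fineK pfin) lee_fin.
have qk : (l * m) ^+ k @[k --> \oo] --> (0 : R).
  by apply: cvg_expr; rewrite ger0_norm// mulr_ge0.
have bound k :
  a * expR (- (s * x)) - (l * m) ^+ k <= fine (P (\bigcup_k ruined k)).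
  rewrite -lee_fin fineK//.
  apply: (le_trans (ruin_ge indep x0 k rs a01 lE mE gstep)).
  by apply: le_measure; rewrite ?inE// => w rw; exists k.
have lim : a * expR (- (s * x)) - (l * m) ^+ k @[k --> \oo] -->
    a * expR (- (s * x)) - 0 by apply: cvgB => //; exact: cvg_cst.
rewrite -[leLHS]subr0 -(cvg_lim _ lim)//.
apply: limr_le; first by apply: cvgP lim.
by apply: nearW.
Qed.

End infinite_horizon.

Section exponents.
Variable R : realFieldType.

(** The left-hand side is the mean discount [E exp (- r c W)] for [n = q ^ 2],
    written so as to be compared with the expansion of the moment generating
    function at [r / q]. *)
Lemma premium_laplaceE (q lam mu theta r : R) :
  0 < q -> 0 < lam -> 0 < mu -> 0 < theta -> 0 <= r ->
  q ^+ 2 * lam / (q ^+ 2 * lam + r * ((q + theta) * lam * mu)) =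
  (1 + r / q * mu * (1 + theta / q))^-1.
Proof.
move=> q0 l0 mu0 t0 r0.
have q0' := lt0r_neq0 q0; have l0' := lt0r_neq0 l0.
apply: (can_inj invrK); rewrite invrK invfM invrK.
by field; rewrite q0' l0'.
Qed.

(** At the adjustment rate the quadratic term of the expansion is exactly the
    contribution of the safety loading. *)
Lemma mgf_at_adjustment (gamma mu mu2 theta e m : R) :
  gamma * mu2 = 2 * theta * mu ->
  let s := gamma * e in
  1 + s * mu + s ^+ 2 * mu2 / 2 <= m -> 1 + s * mu * (1 + theta * e) <= m.
Proof.
move=> gE s; apply: le_trans; rewrite le_eqVlt; apply/orP; left; apply/eqP.
have -> : s ^+ 2 * mu2 / 2 = s * e * (gamma * mu2) / 2 by rewrite /s; field.
by rewrite gE; field.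
Qed.

(** Lowering the rate by [K * e] puts the quadratic term below the contribution
    of the safety loading by an amount of order [e ^+ 3], which for this [K]
    exceeds the cubic remainder. *)
Lemma mgf_below_adjustment (gamma mu mu2 theta C e m : R) :
  0 < mu2 -> 0 <= C -> 0 < e -> 0 < gamma -> gamma * mu2 = 2 * theta * mu ->
  let K := 2 * C * gamma ^+ 2 / mu2 + 1 in
  let s := (gamma - K * e) * e in
  0 < s -> m <= 1 + s * mu + s ^+ 2 * mu2 / 2 + C * s ^+ 3 ->
  m < 1 + s * mu * (1 + theta * e).
Proof.
move=> m20 C0 e0 g0 gE K s s0 mle; apply: le_lt_trans mle _.
have K0 : 0 <= K.
  by rewrite addr_ge0// divr_ge0 ?(ltW m20)// mulr_ge0 ?sqr_ge0// mulr_ge0.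
have KE : K * mu2 = 2 * C * gamma ^+ 2 + mu2.
  by rewrite mulrDl divfK ?mul1r// gt_eqF.
have sg : s ^+ 2 <= (gamma * e) ^+ 2.
  apply: lerXn2r; rewrite ?nnegrE.
  - exact: ltW.
  - by rewrite mulr_ge0// ltW.
  - by rewrite /s ler_pM2r// gerBl mulr_ge0// ltW.
have : s * (s * mu2 / 2 + C * s ^+ 2 - mu * theta * e) < 0.
  rewrite pmulr_rlt0//.
  have -> : s * mu2 / 2 = mu * theta * e - e ^+ 2 * (K * mu2) / 2.
    have -> : s * mu2 / 2 = e * (gamma * mu2) / 2 - e ^+ 2 * (K * mu2) / 2.
      by rewrite /s; field.
    by rewrite gE; field.
  have := ler_wpM2l C0 sg.
  have : 0 < e ^+ 2 * mu2 by rewrite mulr_gt0// exprn_gt0.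
  rewrite KE; lra.
have -> : C * s ^+ 3 = s * (C * s ^+ 2) by ring.
have -> : s ^+ 2 * mu2 / 2 = s * (s * mu2 / 2) by field.
lra.
Qed.

End exponents.

(** The difference is at most [delta * x * expR (- (gamma / 2 * x))], and
    [y * expR (- y) <= 1] makes this bound uniform in [x]. *)
Lemma expR_decrement (R : realType) (gamma delta x : R) :
  0 < gamma -> 0 <= delta <= gamma / 2 -> 0 <= x ->
  expR (- ((gamma - delta) * x)) - expR (- (gamma * x)) <= 2 / gamma * delta.
Proof.
move=> g0 /andP[d0 dg] x0.
have -> : expR (- (gamma * x)) =
    expR (- ((gamma - delta) * x)) * expR (- (delta * x)).
  by rewrite -expRD; congr expR; ring.
rewrite -[X in X - _]mulr1 -mulrBr.
apply: (@le_trans _ _ (expR (- (gamma / 2 * x)) * (delta * x))).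
  apply: ler_pM; rewrite ?expR_ge0//.
  - by rewrite subr_ge0 -[leRHS]expR0 ler_expR oppr_le0 mulr_ge0.
  - by rewrite ler_expR lerN2 ler_wpM2r//; lra.
  - by have := expR_ge1Dx (- (delta * x)); lra.
have : gamma / 2 * x <= expR (gamma / 2 * x).
  by apply: le_trans (expR_ge1Dx _); rewrite lerDr.
move=> /(ler_wpM2l (expR_ge0 (- (gamma / 2 * x)))).
rewrite -expRD addNr expR0 => H.
have -> : expR (- (gamma / 2 * x)) * (delta * x) =
  2 / gamma * delta * (expR (- (gamma / 2 * x)) * (gamma / 2 * x)).
  by field; rewrite gt_eqF.
by rewrite ler_piMr// mulr_ge0// divr_ge0// ltW.
Qed.

Section tail_transfer.
Context d (T : measurableType d) (R : realType) (P : probability T R).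

Lemma tail_same_distribution (X Y : {RV P >-> R}) (d0 : R) :
  same_distribution P X Y ->
  P [set w | (d0 < X w)%R] = P [set w | (d0 < Y w)%R].
Proof.
move=> XY.
have E (Z : {RV P >-> R}) : P [set w | (d0 < Z w)%R] =
    distribution P Z `]d0, +oo[%classic.
  congr (P _); by apply/seteqP; split => w /=; rewrite in_itv/= andbT.
by rewrite !E XY.
Qed.

Lemma integral_tail_same_distribution (X Y : {RV P >-> R}) (f : R -> R)
    (d0 : R) :
  same_distribution P X Y -> measurable_fun setT f -> (forall v, 0 <= f v) ->
  (\int[P]_(w in [set w | (d0 < X w)%R]) (f (X w))%:E =
   \int[P]_(w in [set w | (d0 < Y w)%R]) (f (Y w))%:E)%E.
Proof.
move=> XY mf f0.
pose phi v : \bar R := (if d0 < v then f v else 0)%:E.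
have E (Z : {RV P >-> R}) :
    (\int[P]_(w in [set w | (d0 < Z w)%R]) (f (Z w))%:E =
     \int[P]_w phi (Z w))%E.
  rewrite integral_mkcond; apply: eq_integral => w _; rewrite /phi patchE.
  case: ltP => dZ; first by rewrite mem_set.
  by rewrite memNset//=; apply/negP; rewrite -leNgt.
rewrite !E; apply: integral_same_distribution => //.
  by apply/measurable_EFinP; apply: measurable_fun_ifT => //;
    exact: measurable_fun_ltr.
by move=> v; rewrite lee_fin /phi; case: ifP.
Qed.

End tail_transfer.

(** * The rate of convergence *)

Lemma ruin_time_lty d (T : measurableType d) (R : realType)
    (P : probability T R) (lambda theta : R) (Y : T -> R) (Ys : nat -> T -> R)
    (N : R -> R -> T -> nat) (n x : R) (w : T) :
  (ruin_time P lambda theta Y Ys N n x w < +oo)%E <->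
  exists2 t, 0 <= t & surplus P lambda theta Y Ys N n x t w < 0.
Proof.
split; first by move=> /ereal_inf_lt[_ [t [t0 neg] _] _]; exists t.
move=> [t t0 neg]; apply: (@le_lt_trans _ _ t%:E); last exact: ltry.
by apply: ereal_inf_lbound; exists t.
Qed.

Theorem theorem4p1 (d : measure_display) (T : measurableType d) (R : realType)
  (P : probability T R) (lambda theta : R)
  (Y : {RV P >-> R}) (Ys : nat -> {RV P >-> R}) (N : R -> R -> T -> nat)
  (lambda_gt0 : 0 < lambda) (theta_gt0 : 0 < theta)
  (Y_gt0 : {ae P, forall w, 0 < Y w})
  (Y_mgf : exists2 u0 : R, 0 < u0 &
     forall u : R, `|u| < u0 -> ('M_P Y u < +oo)%E)
  (Ys_copies : forall i, same_distribution P (Ys i) Y)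
  (Ys_indep : mutually_independent P (fun i => (Ys i : T -> R)))
  (N_poisson : forall n : R, 0 < n -> poisson_process P (n * lambda) (N n))
  (N_Ys_indep : forall n : R, 0 < n ->
     independent_systems P
       (sigma_generated [set t : R | 0 <= t] (N n))
       (sigma_generated [set: nat] (fun i => (Ys i : T -> R)))) :
  let gamma := adjustment P theta Y in
  (exists2 m : R, 0 < m &
     (ereal_sup
        [set cond_expectation P
               (fun w => ((Y w - d0) ^+ 2 *
                          expR (gamma / Num.sqrt m * (Y w - d0)))%R)
               [set w | (d0 < Y w)%R]
        | d0 in [set d0 : R | (0 <= d0)%R /\ (0 < P [set w | (d0 < Y w)%R])%E]]
      < +oo)%E) ->
  exists C N0 : R, [/\ 0 < C, 0 < N0 &
    forall n x : R, N0 < n -> 0 <= x ->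
      `| ruin_prob P lambda theta Y (fun i => (Ys i : T -> R)) N n x
         - ruin_prob_diffusion P theta Y x | <= C / Num.sqrt n].
Proof.
move=> gamma [m0 m00 tail].
have [t [C [t0 C0 mu0 mu20 taylor]]] := mgf_taylor Y_gt0 Y_mgf.
set mu := mean_claim P Y in mu0 taylor.
set mu2 := mean_sq_claim P Y in mu20 taylor.
have gE : gamma * mu2 = 2 * theta * mu.
  by rewrite /gamma /adjustment divfK// gt_eqF.
have g0 : 0 < gamma by rewrite divr_gt0// !mulr_gt0.
have sm0 : 0 < Num.sqrt m0 by rewrite sqrtr_gt0.
have [A A0 over] := overshoot (divr_ge0 (ltW g0) (ltW sm0)) tail.
pose K := 2 * C * gamma ^+ 2 / mu2 + 1.
have K0 : 0 <= K.
  by rewrite addr_ge0// divr_ge0 ?(ltW mu20)// mulr_ge0 ?sqr_ge0// mulr_ge0.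
(* [B <= sqrt n] ensures that [gamma * e] is in the range of the Taylor
   expansion, that the moment condition covers [gamma * e], and that
   [gamma - K * e] is at least [gamma / 2]. *)
pose B := gamma / t + Num.sqrt m0 + 2 * K / gamma + 1.
have gt0 : 0 < gamma / t by rewrite divr_gt0.
have Kg0 : 0 <= 2 * K / gamma.
  exact: divr_ge0 (mulr_ge0 (ler0n _ 2) K0) (ltW g0).
have B0 : 0 < B by rewrite /B; lra.
(* The first two terms are the errors of the upper and of the lower bound; the
   last one makes the constant positive. *)
exists (2 / gamma * K + gamma * A + 1), (B ^+ 2); split.
- apply: ltr_wpDl => //; apply: addr_ge0; apply: mulr_ge0 => //;
  last exact: ltW.
  by rewrite divr_ge0// ltW.
- by rewrite exprn_gt0.
move=> n x nB x0.
have n0 : 0 < n by apply: lt_trans nB; rewrite exprn_gt0.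
pose q := Num.sqrt n; pose e := q^-1.
have Bq : B < q.
  by rewrite -[B]gtr0_norm// -sqrtr_sqr ltr_sqrt.
have q0 : 0 < q by apply: lt_trans Bq.
have nE : n = q ^+ 2 by rewrite sqr_sqrtr// ltW.
have e0 : 0 < e by rewrite invr_gt0.
have get : gamma * e <= t.
  by rewrite /e ler_pdivrMr// mulrC -ler_pdivrMr//; rewrite /B in Bq; lra.
have gek : gamma * e <= gamma / Num.sqrt m0.
  by rewrite ler_pM2l// /e lef_pV2 ?posrE//; rewrite /B in Bq; lra.
have Keg : K * e <= gamma / 2.
  rewrite /e ler_pdivrMr// mulrAC ler_pdivlMr// mulrC (mulrC gamma) -ler_pdivrMr//.
  by rewrite /B in Bq; lra.
have Ke0 : 0 <= K * e by rewrite mulr_ge0// ltW.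
pose r := gamma - K * e.
have r0 : 0 < r by rewrite /r; lra.
have rg : r <= gamma by rewrite /r; lra.
have [W [Windep Wlaw W0 NW]] := N_poisson n n0.
have indep : mutually_independent P (fun i => (sum_family W Ys i : T -> R)).
  apply: mutually_independent_sum => // F G sF sG.
  apply: (N_Ys_indep n n0) => //.
  by apply: interarrival_sigma_generated sF => // s w k; exact: NW.
pose c := premium_rate P lambda theta Y n.
have c0 : 0 <= c.
  apply: mulr_ge0; last exact: ltW.
  by apply: mulr_ge0; [apply: addr_ge0|]; exact: ltW.
pose l s := (1 + s / q * mu * (1 + theta / q))^-1.
have lE s : 0 <= s -> forall k,
    (\int[P]_w (expR (- (s * (c * W k w))))%:E = (l s)%:E)%E.
  move=> s0 k;
    rewrite /l -(premium_laplaceE q0 lambda_gt0 mu0 theta_gt0 s0) -nE.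
  rewrite -(@exponential_laplace _ _ _ P (W k)) ?mulr_gt0//; last 2 first.
  - exact: (mulr_ge0 s0 c0).
  - by move=> D mD; rewrite Wlaw.
  apply: eq_integral => w _; congr (expR (- _))%:E.
  exact: (mulrA s c (W k w)).
have mE s m : (\int[P]_w (expR (s * e * Y w))%:E = m%:E)%E -> forall k,
    (\int[P]_w (expR (s * (e * Ys k w)))%:E = m%:E)%E.
  move=> <- k.
  rewrite -(@integral_same_distribution _ _ _ P (Ys k) Y
    (fun v => (expR (s * e * v))%:E) (Ys_copies k)).
  - by apply: eq_integral => w _; rewrite mulrA.
  - by apply/measurable_EFinP; apply: measurableT_comp.
  - by move=> v; rewrite lee_fin expR_ge0.
have den0 s : 0 <= s -> 0 < 1 + s / q * mu * (1 + theta / q).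
  move=> s0; apply: ltr_wpDr => //.
  have th : 0 <= 1 + theta / q by rewrite addr_ge0// divr_ge0// ltW.
  by rewrite mulr_ge0// mulr_ge0 ?(ltW mu0)// divr_ge0// ltW.
have [|m1 [m1E /andP[m1lo _]]] := taylor (gamma * e).
  by rewrite get mulr_ge0// ltW.
have lm1 : 1 <= l gamma * m1.
  rewrite /l mulrC ler_pdivlMr ?mul1r; last by apply: den0; exact: ltW.
  exact: (mgf_at_adjustment (theta := theta) gE m1lo).
have [|m2 [m2E /andP[_ m2hi]]] := taylor (r * e).
  apply/andP; split; first by rewrite mulr_ge0// ltW.
  by apply: le_trans get; rewrite ler_pM2r.
have lm2 : l r * m2 < 1.
  rewrite /l mulrC ltr_pdivrMr ?mul1r; last by apply: den0; exact: ltW.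
  by apply: (mgf_below_adjustment mu20 C0 e0 g0 gE) m2hi; rewrite mulr_gt0.
pose a := (1 + gamma * e * A)^-1.
have geA : 0 <= gamma * e * A by rewrite mulr_ge0// mulr_ge0// ltW.
have a01 : 0 <= a <= 1.
  by rewrite invr_ge0 invf_le1 ?lerDl ?addr_ge0//= ltr_wpDr.
have over' k d0 : 0 <= d0 ->
    (\int[P]_(w in [set w | (d0 < Ys k w)%R])
       (expR (gamma * e * (Ys k w - d0)))%:E
      <= (1 + gamma * e * A)%:E * P [set w | (d0 < Ys k w)%R])%E.
  move=> d00; rewrite (tail_same_distribution _ (Ys_copies k)).
  rewrite (@integral_tail_same_distribution _ _ _ P _ _
    (fun v => expR (gamma * e * (v - d0))) _ (Ys_copies k)).
  - by apply: over => //; rewrite gek mulr_ge0// ltW.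
  - apply: measurableT_comp => //; apply: measurable_funM => //.
    exact: measurable_funB.
  - by move=> v; exact: expR_ge0.
pose U := \bigcup_k [set w | stopped W Ys c e x k w < 0].
have -> : ruin_prob P lambda theta Y (fun i => (Ys i : T -> R)) N n x =
    fine (P U).
  rewrite /ruin_prob; congr (fine (P _)).
  have iff w := @ruin_at_claims _ _ _ P W Ys c q x (N n) w c0
    (fun k => W0 k w) (fun s k => NW s w k).
  apply/seteqP; split => w /=.
    by move=> /ruin_time_lty /iff [k]; exists k.
  by move=> [k _ neg]; apply/ruin_time_lty/iff; exists k.
have pfin : P U \is a fin_num.
  by apply: fin_num_measure; exact: measurable_ever_ruined.
have upper : fine (P U) <= expR (- (r * x)).
  rewrite -lee_fin fineK// /U.
  apply: (ever_ruined_le x indep (ltW r0) (lE _ (ltW r0)) (mE _ _ m2E)).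
  exact: ltW.
have lower : a * expR (- (gamma * x)) <= fine (P U).
  rewrite -lee_fin fineK// /U.
  apply: (ever_ruined_ge indep x0 _ a01 (lE _ (ltW r0)) (mE _ _ m2E) lm2).
    by rewrite rg ltW.
  exact: (one_step_subsolution W0 c0 e0 (ltW g0) A0 (lE _ (ltW g0))
    (mE _ _ m1E)).
rewrite /ruin_prob_diffusion -/gamma.
have E1 : expR (- (gamma * x)) <= 1.
  by rewrite -[leRHS]expR0 ler_expR oppr_le0 mulr_ge0// ltW.
have dec : expR (- (r * x)) - expR (- (gamma * x)) <= 2 / gamma * (K * e).
  by apply: expR_decrement => //; rewrite Ke0.
have loss : (1 - a) * expR (- (gamma * x)) <= gamma * e * A.
  have aE : 1 - a = a * (gamma * e * A).
    have : a * (1 + gamma * e * A) = 1 by rewrite mulVf// gt_eqF// ltr_wpDr.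
    lra.
  case/andP: a01 => a0 a1.
  apply: (@le_trans _ _ (1 - a)); first by rewrite ler_piMr// subr_ge0.
  by rewrite aE ler_piMl.
have -> : (2 / gamma * K + gamma * A + 1) / Num.sqrt n =
    2 / gamma * (K * e) + gamma * e * A + e by rewrite -/q -/e; ring.
rewrite ler_norml; apply/andP; split.
  have := mulr_ge0 (divr_ge0 (ler0n R 2) (ltW g0)) Ke0; lra.
lra.
Qed.
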